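(* The point configuration $A$ is dual defective if and only if $P_A(t)$ is trivial (i.e. is the zero polynomial).
   Context: Setting. Let $n\ge1$ and let $A=(\alpha_1,\dots,\alpha_N)$ be a real $(1+n)\times N$ matrix (a point configuration; columns need not be distinct) of rank $1+n$ whose top row is the all ones vector. Let $m=N-n-1\ge 1$. Let $\hat A$ be the $n\times N$ matrix obtained by deleting the top row of $A$. A Gale dual of $A$ is an $N\times m$ matrix $B$ of rank $m$ with $AB=0$; fix one, with rows $\beta_1,\dots,\beta_N$, and write $\langle\beta,t\rangle=\sum_i\beta_it_i$ for $t\in\mathbb{C}^m$. Cuspidal form. With $\Sigma$ the set of $n$-element subsets $\sigma\subset\{1,\dots,N\}$ and $|\hat A_\sigma|$ the determinant of the $n\times n$ submatrix of $\hat A$ with columns in $\sigma$, $$P_A(t)=\sum_{\sigma\in\Sigma}|\hat A_\sigma|^2\prod_{k\in\sigma}\langle\beta_k,t\rangle .$$ (A different choice of Gale dual changes $P_A$ only by an invertible linear change of the variables $t$.) Discriminant variety. $(\mathbb{C}^\times)^A$ denotes the family of exponential sums $f(w)=\sum_k c_k e^{\langle w,\alpha_k\rangle}$, $w\in\mathbb{C}^{1+n}$, $c_k\in\mathbb{C}^\times$, identified with $(c_1,\dots,c_N)$. The dual variety $\check X_A\subset(\mathbb{C}^\times)^A$ is the set of all $f$ having a singular point, i.e. a point $w$ where $f$ and all its first partial derivatives vanish. $A$ is dual defective if $\check X_A$ has (complex) codimension at least $2$ in $(\mathbb{C}^\times)^A$, i.e. if $\check X_A$ contains no locally closed complex submanifold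 of $(\mathbb{C}^\times)^A$ of dimension $N-1$ (in particular if $\check X_A$ is empty). *)

(* Defs.v *)
From HB Require Import structures.
From mathcomp Require Import all_boot all_order all_algebra.
From mathcomp Require Import all_classical all_reals all_analysis.
From mathcomp Require Import complex.
From mathcomp Require mpoly.
Export (canonicals) mpoly.

Set Implicit Arguments.
Unset Strict Implicit.
Unset Printing Implicit Defensive.

Import Order.TTheory GRing.Theory Num.Theory.
Import numFieldNormedType.Exports.

Local Open Scope classical_set_scope.
Local Open Scope ring_scope.

(* Packing R[i] as a numClosedFieldType gives it, and the spaces of matrices
   over it, the topology and normed module structures that MathComp-Analysis
   attaches to an arbitrary numClosedFieldType.  Hence [differentiable] and
   ['D_v] below are taken over the scalars R[i], i.e. in the complex sense. *)
Definition Cplx (R : realType) : numClosedFieldType := R[i].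

Definition toC (R : realType) (x : R) : Cplx R := x%:C%C.

Definition cexp (R : realType) (z : Cplx R) : Cplx R :=
  toC (expR (complex.Re z)) *
  ((cos (complex.Im z)) +i* (sin (complex.Im z)))%C.

Definition point_configuration (R : realType) (n N : nat)
    (A : 'M[R]_(n.+1, N)) : Prop :=
  \rank A = n.+1 /\ forall k : 'I_N, A ord0 k = 1.

(* Complex entries are allowed, so real Gale duals are a special case. *)
Definition gale_dual (R : realType) (n N m : nat) (A : 'M[R]_(n.+1, N))
    (B : 'M[Cplx R]_(N, m)) : Prop :=
  \rank B = m /\ map_mx (@toC R) A *m B = 0.

Definition hat (R : realType) (n N : nat) (A : 'M[R]_(n.+1, N)) :
  'M[R]_(n, N) := row' ord0 A.

Definition subsets (n N : nat) := {sigma : {set 'I_N} | #|sigma| == n}.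

(* [enum_val] lists the columns in sigma in increasing order. *)
Definition minor (R : realType) (n N : nat) (M : 'M[R]_(n, N))
    (sigma : subsets n N) : R :=
  \det (colsub
    (fun j : 'I_n => enum_val (cast_ord (esym (eqP (valP sigma))) j)) M).

Definition linear_form (R : realType) (N m : nat) (B : 'M[Cplx R]_(N, m))
    (k : 'I_N) : mpoly.mpoly m (Cplx R) :=
  \sum_(i < m) B k i *: mpoly.mpolyX (Cplx R) (mpoly.mnm1 i).

Definition cuspidal_form (R : realType) (n N m : nat) (A : 'M[R]_(n.+1, N))
    (B : 'M[Cplx R]_(N, m)) : mpoly.mpoly m (Cplx R) :=
  \sum_(sigma : subsets n N)
    toC (minor (hat A) sigma ^+ 2) *:
      \prod_(k in val sigma) linear_form B k.

Definition torus (R : realType) (N : nat) : set 'rV[Cplx R]_N :=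
  [set c | forall k, c ord0 k != 0].

Definition exp_sum (R : realType) (n N : nat) (A : 'M[R]_(n.+1, N))
    (c : 'rV[Cplx R]_N) (w : 'rV[Cplx R]_n.+1) : Cplx R :=
  \sum_(k < N) c ord0 k * cexp (\sum_(j < n.+1) w ord0 j * toC (A j k)).

(* The library's derivative ['D_v f w] is total; it is a genuine limit for the
   entire functions [exp_sum A c], the only ones this is applied to. *)
Definition singular_point (R : realType) (d : nat)
    (f : 'rV[Cplx R]_d -> Cplx R) (w : 'rV[Cplx R]_d) : Prop :=
  f w = 0 /\ forall j : 'I_d, 'D_(delta_mx ord0 j) f w = 0.

Definition dual_variety (R : realType) (n N : nat) (A : 'M[R]_(n.+1, N)) :
  set 'rV[Cplx R]_N :=
  [set c | torus c /\ exists w, singular_point (exp_sum A c) w].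

Definition locally_closed (T : topologicalType) (S : set T) : Prop :=
  exists U F : set T, [/\ open U, closed F & S = U `&` F].

Definition biholomorphic (R : realType) (N : nat)
    (U V : set 'rV[Cplx R]_N) (phi : 'rV[Cplx R]_N -> 'rV[Cplx R]_N) : Prop :=
  [/\ open U, open V, phi @` U = V,
      (forall x, U x -> differentiable phi x) &
      exists psi : 'rV[Cplx R]_N -> 'rV[Cplx R]_N,
        (forall x, U x -> psi (phi x) = x) /\
        (forall y, V y -> differentiable psi y)].

(* Embedded, given by straightening charts of the ambient space.  The empty set
   is excluded: it would otherwise have every dimension. *)
Definition complex_submanifold (R : realType) (N d : nat)
    (S : set 'rV[Cplx R]_N) : Prop :=
  [/\ (d <= N)%N, S !=set0 & forall p, S p ->
    exists (U V : set 'rV[Cplx R]_N) (phi : 'rV[Cplx R]_N -> 'rV[Cplx R]_N),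
      [/\ U p, biholomorphic U V phi &
          phi @` (S `&` U) =
            [set y | V y /\ forall i : 'I_N, (d <= i)%N -> y ord0 i = 0]]].

Definition dual_defective (R : realType) (n N : nat) (A : 'M[R]_(n.+1, N)) :
  Prop :=
  ~ exists S : set 'rV[Cplx R]_N,
      [/\ locally_closed S, complex_submanifold N.-1 S & S `<=` dual_variety A].

(* Main.v *)
(* A singular point of c satisfies A (c_k e^<w, alpha_k>)_k = 0, so by Gale duality
   c_k = <beta_k, t> e^-<w, alpha_k>; rescaling t absorbs the first coordinate of w.
   Hence the dual variety is the part in the torus of the image of the map
   G : C^m x C^n -> C^N, G(t, w)_k = <beta_k, t> e^<w, hat alpha_k>, where
   m + n = N - 1.  The kernel of dG at (t, w) is isomorphic to the kernel of
   hat A diag(<beta_k, t>) hat A^T, whose determinant is P_A(t) by Cauchy-Binet.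

   If P_A is not zero, then G is an immersion near some point (t, 0) sent into the
   torus, and the inverse function theorem for (x, y) |-> G(x) + y e, with e
   transverse to the image of dG, yields a hypersurface in the dual variety.

   If P_A = 0, then dG is everywhere singular.  Pulling the image of G back by a
   chart of a would-be hypersurface covers an open subset of C^(N-1) by countably
   many sets, each of which is nowhere dense by counting points (a quantitative
   Sard theorem); this contradicts the Baire property. *)

Require Import Defs.
From HB Require Import structures.
From mathcomp Require Import all_boot all_order all_algebra.
From mathcomp Require Import all_classical all_reals all_analysis.
From mathcomp Require Import fingroup perm complex ring lra zify.

Set Implicit Arguments.
Unset Strict Implicit.
Unset Printing Implicit Defensive.

Import Order.TTheory GRing.Theory Num.Theory.
Import numFieldNormedType.Exports.
Import (coercions) mpoly.

Local Open Scope classical_set_scope.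
Local Open Scope ring_scope.

(** * Real-valued norms over the complex numbers *)

(** A chart of the hypersurface is only known to be differentiable at each point, so its Lipschitz
    constant may vary from point to point. This dictates the countable decomposition: for each [k],
    collect the chart parameters of points that have a preimage of norm at most [k] and at which the
    chart satisfies a [k]-Lipschitz bound up to distance 1/(k+1). On one such set all constants are
    uniform, so counting applies. The inverse function theorem is only needed for maps of the shape
    p e^q + r with p, q, r linear. On every ball they have a quadratic Taylor remainder and a
    Lipschitz derivative with explicit constants, so the radius of inversion can be chosen directly
    from these. *)

HB.instance Definition _ (R : realType) :=
  GRing.RMorphism.copy (@toC R) (real_complex R).

(* The library's norms on these spaces take values in the complex field itself;
   [nrm] moves estimates to the ordered field R. *)
Definition nrm (R : realType) (V : normedZmodType (Cplx R)) (x : V) : R :=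
  complex.Re `|x|.

Section RealNorm.
Context {R : realType}.
Notation C := (Cplx R).

Lemma ler_toC (a b : R) : (toC a <= toC b) = (a <= b).
Proof. exact: lecR. Qed.

Lemma ltr_toC (a b : R) : (toC a < toC b) = (a < b).
Proof. exact: ltcR. Qed.

Lemma toC_Re (z : C) : 0 <= z -> toC (complex.Re z) = z.
Proof. by move=> z0; apply: RRe_real; rewrite ger0_real. Qed.

Lemma toC_eq0 (a : R) : (toC a == 0) = (a == 0).
Proof. exact: fmorph_eq0. Qed.

Section Abstract.
Context {V : normedZmodType C}.
Implicit Types x y : V.

Lemma nrmE x : `|x| = toC (nrm x).
Proof. by rewrite /nrm toC_Re. Qed.

Lemma nrm_ge0 x : 0 <= nrm x.
Proof. by rewrite -ler_toC -nrmE rmorph0. Qed.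

Lemma nrmD x y : nrm (x + y) <= nrm x + nrm y.
Proof. by rewrite -ler_toC rmorphD /= -!nrmE ler_normD. Qed.

Lemma nrmN x : nrm (- x) = nrm x.
Proof. by rewrite /nrm normrN. Qed.

Lemma nrmB x y : nrm (x - y) <= nrm x + nrm y.
Proof. by rewrite -(nrmN y) nrmD. Qed.

Lemma nrm_distC x y : nrm (x - y) = nrm (y - x).
Proof. by rewrite /nrm distrC. Qed.

Lemma nrm_tri z x y : nrm (x - y) <= nrm (x - z) + nrm (z - y).
Proof. by rewrite (le_trans _ (nrmD _ _))// addrA subrK. Qed.

Lemma nrm0 : nrm (0 : V) = 0.
Proof. by rewrite /nrm normr0. Qed.

Lemma nrm_eq0 x : (nrm x == 0) = (x == 0).
Proof. by rewrite -toC_eq0 -nrmE normr_eq0. Qed.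

Lemma nrm_le0 x : nrm x <= 0 -> x = 0.
Proof. by move=> h; apply/eqP; rewrite -nrm_eq0 eq_le h nrm_ge0. Qed.

Lemma nrm_gt0 x : (0 < nrm x) = (x != 0).
Proof. by rewrite lt_neqAle nrm_ge0 andbT eq_sym nrm_eq0. Qed.

End Abstract.

Lemma nrm_sum (V : normedZmodType C) I (r : seq I) (P : pred I) (F : I -> V) :
  nrm (\sum_(i <- r | P i) F i) <= \sum_(i <- r | P i) nrm (F i).
Proof.
elim/big_rec2 : _ => [|i y x _ h]; first by rewrite nrm0.
by rewrite (le_trans (nrmD _ _))// lerD2l.
Qed.

Lemma nrmZ (V : normedModType C) (a : C) (x : V) : nrm (a *: x) = nrm a * nrm x.
Proof.
by apply: complexI; rewrite -[RHS]/(toC _) rmorphM /= -!nrmE -normrZ nrmE.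
Qed.

Lemma nrmM (a b : C) : nrm (a * b) = nrm a * nrm b.
Proof.
by apply: complexI; rewrite -[RHS]/(toC _) rmorphM /= -!nrmE -normrM nrmE.
Qed.

Lemma nrm_toC (a : R) : nrm (toC a : C) = `|a|.
Proof. by rewrite /nrm -[`|toC a|]/(`|(a%:C)%C|) normc_def /= expr0n /= addr0 sqrtr_sqr. Qed.

Lemma nrm1 : nrm (1 : C) = 1.
Proof. by rewrite /nrm normr1. Qed.

Lemma nrmC_def (z : C) :
  nrm z = Num.sqrt (complex.Re z ^+ 2 + complex.Im z ^+ 2).
Proof. by rewrite /nrm -[`|z|]/(`|(z : R[i])|) normc_def. Qed.

Lemma Re_le_nrm (z : C) : `|complex.Re z| <= nrm z.
Proof.
by rewrite nrmC_def -sqrtr_sqr ler_wsqrtr// lerDl sqr_ge0.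
Qed.

Lemma Im_le_nrm (z : C) : `|complex.Im z| <= nrm z.
Proof.
by rewrite nrmC_def -sqrtr_sqr ler_wsqrtr// lerDr sqr_ge0.
Qed.

Lemma nrm_le_ReIm (z : C) : nrm z <= `|complex.Re z| + `|complex.Im z|.
Proof.
rewrite nrmC_def -[leRHS]ger0_norm ?addr_ge0// -[leRHS]sqrtr_sqr ler_wsqrtr//.
rewrite sqrrD !real_normK ?num_real// -addrA lerD2l lerDr.
by rewrite mulrn_wge0// mulr_ge0.
Qed.

Section Matrix.
Context {p q : nat}.
Implicit Types x y : 'M[C]_(p, q).

Lemma nrm_coord x i j : nrm (x i j) <= nrm x.
Proof.
rewrite -ler_toC -!nrmE.
rewrite [leRHS]/Num.Def.normr/= mx_normE -[leLHS]nngE num_le.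
exact: (le_bigmax _ (fun ij => `|x ij.1 ij.2|%:nng) (i, j)).
Qed.

Lemma nrm_mx_le x (c : R) : 0 <= c -> (forall i j, nrm (x i j) <= c) -> nrm x <= c.
Proof.
move=> c0 h; have [->|x0] := eqVneq x 0; first by rewrite nrm0.
have /mx_norm_neq0[[i j] /= e] : mx_norm x != 0.
  by apply: contra x0 => /eqP/mx_norm_eq0 ->.
by rewrite /nrm [`|x|]/Num.Def.normr/= e; apply: h.
Qed.

Lemma nrm_mx_lt x (c : R) : 0 < c -> (forall i j, nrm (x i j) < c) -> nrm x < c.
Proof.
move=> c0 h; have [->|x0] := eqVneq x 0; first by rewrite nrm0.
have /mx_norm_neq0[[i j] /= e] : mx_norm x != 0.
  by apply: contra x0 => /eqP/mx_norm_eq0 ->.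
by rewrite /nrm [`|x|]/Num.Def.normr/= e; apply: h.
Qed.

End Matrix.

Lemma nrm_mulmx_ex p q (M : 'M[C]_(p, q)) :
  exists c : R, 0 < c /\ forall k (x : 'M[C]_(k, p)), nrm (x *m M) <= c * nrm x.
Proof.
have c0 : 0 <= \sum_i \sum_j nrm (M i j).
  by apply: sumr_ge0 => i _; apply: sumr_ge0 => j _; exact: nrm_ge0.
(* The added 1 makes the constant positive even for M = 0, so that later radii can be divided by
   it. *)
exists (\sum_i \sum_j nrm (M i j) + 1); split; first lra.
move=> k x; apply: nrm_mx_le => [|i j].
  by rewrite mulr_ge0 ?nrm_ge0//; lra.
rewrite mxE (le_trans (nrm_sum _ _ _))// mulrDl mul1r.
rewrite (@le_trans _ _ ((\sum_i \sum_j nrm (M i j)) * nrm x))//; last first.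
  by rewrite lerDl nrm_ge0.
rewrite mulr_suml ler_sum// => l _; rewrite nrmM mulrC.
rewrite ler_pM ?nrm_ge0 ?nrm_coord//.
by rewrite (bigD1 j)//= lerDl sumr_ge0// => *; exact: nrm_ge0.
Qed.

Lemma nbhs_nrmP (V : normedModType C) (x : V) (A : set V) :
  nbhs x A <-> exists e : R, 0 < e /\ forall y, nrm (y - x) < e -> A y.
Proof.
split=> [/nbhs_normP[e /= e0 h]|[e [e0 h]]].
- exists (complex.Re e); split.
    by rewrite -ltr_toC toC_Re ?ltW// rmorph0.
  move=> y yx; apply: h => /=.
  by rewrite distrC nrmE -(toC_Re (ltW e0)) ltr_toC.
- apply/nbhs_normP; exists (toC e) => /=; first by rewrite -(rmorph0 (@toC R)) ltr_toC.
  by move=> y /=; rewrite distrC nrmE ltr_toC => /h.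
Qed.

Lemma open_nrmP (V : normedModType C) (A : set V) :
  open A <-> forall x, A x ->
    exists e : R, 0 < e /\ forall y, nrm (y - x) < e -> A y.
Proof.
rewrite openE; split=> [h x /h /nbhs_nrmP//|h x /h ?].
exact/nbhs_nrmP.
Qed.

Lemma eqo_nrmP (V W : normedModType C) (f : V -> W) :
  (f =o_ (0 : V) id) <-> forall e : R, 0 < e -> exists d : R, 0 < d /\
    forall h, nrm h < d -> nrm (f h) <= e * nrm h.
Proof.
split.
- move=> /eqoP h e e0.
  have /h/nbhs_nrmP[d [d0 H]] : 0 < toC e by rewrite -(rmorph0 (@toC R)) ltr_toC.
  exists d; split=> // k kd; have := H k; rewrite subr0 => /(_ kd) /=.
  by rewrite !nrmE -rmorphM /= ler_toC.
- move=> h; apply/eqoP => e e0.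
  have e0' : 0 < complex.Re e by rewrite -ltr_toC toC_Re ?ltW// rmorph0.
  have [d [d0 H]] := h _ e0'.
  apply/nbhs_nrmP; exists d; split=> // k; rewrite subr0 => /H /=.
  by rewrite -(toC_Re (ltW e0)) !nrmE -rmorphM /= ler_toC.
Qed.

Lemma mulmx_continuous p q k (M : 'M[C]_(p, q)) :
  continuous (fun x : 'M[C]_(k, p) => x *m M).
Proof.
move=> x A /nbhs_nrmP[e [e0 h]].
have [c [c0 hc]] := nrm_mulmx_ex M.
apply/nbhs_nrmP; exists (e / c); split; first by rewrite divr_gt0.
move=> y yx; apply: h; rewrite -mulmxBl (le_lt_trans (hc _ _))//.
by rewrite mulrC -ltr_pdivlMr.
Qed.

Lemma diff_nrm (V W : normedModType C) (f : V -> W) (L : {linear V -> W}) x :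
  continuous L ->
  (forall e : R, 0 < e -> exists d : R, 0 < d /\
    forall h, nrm h < d -> nrm (f (h + x) - f x - L h) <= e * nrm h) ->
  differentiable f x /\ 'd f x = L :> (V -> W).
Proof.
move=> Lc hL.
have H : f \o shift x = cst (f x) + L +o_ (0 : V) id.
  apply/eqaddoE/eqaddoP => e e0.
  have := eqo_nrmP (fun h => f (h + x) - f x - L h).
  case=> _ /(_ hL) /eqoP /(_ e e0); apply: filterS => h.
  by rewrite /= -addrA -opprD.
have dL := diff_unique Lc H.
split=> //; apply/diff_locallyP; split; first by rewrite dL.
by rewrite dL.
Qed.

(** This is all that is later extracted from a differentiability hypothesis. The bound compares the
    centre [x] with nearby points, not two nearby points with each other. *)
Lemma differentiable_locally_lip (V W : normedModType C) (f : V -> W) x :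
  differentiable f x -> exists k d : R, [/\ 0 < k, 0 < d &
    forall y, nrm (y - x) < d -> nrm (f y - f x) <= k * nrm (y - x)].
Proof.
move=> df; have [dc H] := (iffLR (diff_locallyP x f)) df.
have [c [c0 hc]] : exists c : R, 0 < c /\ forall h, nrm ('d f x h) <= c * nrm h.
  have [/= k k0 hk] := linear_lipschitz dc.
  exists (complex.Re k); split; first by rewrite -ltr_toC toC_Re ?ltW// rmorph0.
  move=> h; have := hk h; rewrite -(toC_Re (ltW k0)) !nrmE -rmorphM /=.
  by rewrite ler_toC.
have /eqo_nrmP /(_ 1 ltr01)[d [d0 hd]] :
    (fun h => f (h + x) - f x - 'd f x h) =o_ (0 : V) id.
  apply/eqoP => e e0; move/eqaddoP : H => /(_ e e0); apply: filterS => h.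
  by rewrite /= [in X in X -> _]opprD addrA.
exists (c + 1), d; split; [lra|by []|] => y /hd /=.
rewrite subrK mul1r mulrDl mul1r => hy.
rewrite -[X in nrm X](subrK ('d f x (y - x))) (le_trans (nrmD _ _))//.
by rewrite addrC lerD.
Qed.

End RealNorm.

(** * The complex exponential and maps x |-> (p_k(x) e^(q_k(x)) + r_k(x))_k *)

(** The radius 2c/2^n is the tail sum of the allowed steps, so the intervals of this radius around u
    n are nested; the supremum of their left ends lies in all of them. *)
Lemma geometric_cvg_real (R : realType) (u : nat -> R) (c : R) :
  (forall n, `|u n.+1 - u n| <= c / 2 ^+ n) ->
  exists l, forall n, `|l - u n| <= 2 * c / 2 ^+ n.
Proof.
move=> h.
have c0 : 0 <= c by have := h 0; rewrite expr0 divr1; apply: le_trans.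
have e n : 2 * c / 2 ^+ n.+1 = c / 2 ^+ n.
  by rewrite exprS invfM mulrA (mulrC 2) mulfK// pnatr_eq0.
have pos n : 0 <= 2 * c / 2 ^+ n by rewrite divr_ge0 ?exprn_ge0// mulr_ge0.
pose v n := u n - 2 * c / 2 ^+ n; pose w n := u n + 2 * c / 2 ^+ n.
have e2 n : 2 * c / 2 ^+ n = c / 2 ^+ n + c / 2 ^+ n.
  by rewrite -mulrA mulr_natl mulr2n.
have vS n : v n <= v n.+1.
  by rewrite /v e e2; have := h n; rewrite ler_norml => /andP[? ?]; lra.
have wS n : w n.+1 <= w n.
  by rewrite /w e e2; have := h n; rewrite ler_norml => /andP[? ?]; lra.
have vw n : v n <= w n by rewrite /v /w; have := pos n; lra.
have vD n k : v n <= v (n + k)%N.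
  elim: k => [|k ih]; first by rewrite addn0.
  by rewrite addnS (le_trans ih).
have wD n k : w (n + k)%N <= w n.
  elim: k => [|k ih]; first by rewrite addn0.
  by rewrite addnS (le_trans _ ih).
have vwnm n m : v n <= w m.
  have [/subnKC <-|/ltnW /subnKC <-] := leqP n m.
    by rewrite (le_trans (vD n (m - n)%N)).
  by rewrite (le_trans (vw _)).
exists (sup (range v)) => n.
have ubv m : ubound (range v) (w m) by move=> _ [k _ <-]; exact: vwnm.
have lw : sup (range v) <= w n.
  by apply: ge_sup => //; exists (v 0); exists 0%N.
have vl : v n <= sup (range v).
  by apply: ub_le_sup; [exists (w 0); exact: ubv|exists n].
by move: lw vl; rewrite /v /w ler_norml => ? ?; apply/andP; split; lra.
Qed.

Lemma geometric_cvg (R : realType) p (x : nat -> 'rV[Cplx R]_p) (c : R) :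
  (forall n, nrm (x n.+1 - x n) <= c / 2 ^+ n) ->
  exists l, forall n, nrm (l - x n) <= 4 * c / 2 ^+ n.
Proof.
move=> h.
have c0 : 0 <= c by have := h 0; rewrite expr0 divr1; apply/le_trans/nrm_ge0.
have hc j n : nrm (x n.+1 0 j - x n 0 j) <= c / 2 ^+ n.
  by rewrite (le_trans _ (h n))//; have := nrm_coord (x n.+1 - x n) 0 j; rewrite !mxE.
have re j : exists a, forall n, `|a - complex.Re (x n 0 j)| <= 2 * c / 2 ^+ n.
  apply: geometric_cvg_real => n; rewrite (le_trans _ (hc j n))//.
  by have := Re_le_nrm (x n.+1 0 j - x n 0 j); case: (x n.+1 0 j); case: (x n 0 j).
have im j : exists a, forall n, `|a - complex.Im (x n 0 j)| <= 2 * c / 2 ^+ n.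
  apply: geometric_cvg_real => n; rewrite (le_trans _ (hc j n))//.
  by have := Im_le_nrm (x n.+1 0 j - x n 0 j); case: (x n.+1 0 j); case: (x n 0 j).
have [a ha] := choice re; have [b hb] := choice im.
exists (\row_j ((a j +i* b j)%C : Cplx R)) => n.
apply: nrm_mx_le => [|i j]; first by rewrite divr_ge0 ?exprn_ge0// mulr_ge0.
rewrite !mxE (le_trans (nrm_le_ReIm _))// ord1.
have -> : 4 * c / 2 ^+ n = 2 * c / 2 ^+ n + 2 * c / 2 ^+ n :> R by ring.
by have := lerD (ha j n) (hb j n); case: (x n 0 j).
Qed.

Section ComplexExp.
Context {R : realType}.
Notation C := (Cplx R).

Lemma cexpD (z w : C) : cexp (z + w) = cexp z * cexp w.
Proof.
rewrite /cexp; case: z => a b; case: w => c d /=.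
rewrite expRD cosD sinD rmorphM /= mulrACA; congr (_ * _).
by apply/eqP; rewrite eq_complex /=; apply/andP; split; apply/eqP; ring.
Qed.

Lemma cexp0 : cexp (0 : C) = 1.
Proof. by rewrite /cexp /= expR0 cos0 sin0 rmorph1 mul1r. Qed.

Lemma cexpNz (z : C) : cexp z * cexp (- z) = 1.
Proof. by rewrite -cexpD subrr cexp0. Qed.

Lemma cexp_neq0 (z : C) : cexp z != 0.
Proof.
by apply/eqP => e; have /eqP := cexpNz z; rewrite e mul0r eq_sym oner_eq0.
Qed.

Lemma nrm_cexp (z : C) : nrm (cexp z) = expR (complex.Re z).
Proof.
rewrite nrmM nrm_toC ger0_norm ?expR_ge0// nrmC_def /= cos2Dsin2 sqrtr1.
exact: mulr1.
Qed.

(** No power series: e^x >= 1 + x bounds from below, and e^-x >= 1 - x with e^x e^-x = 1 gives e^x -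
    1 - x <= x^2 / (1 - x) <= 2 x^2. *)
Lemma expR_quad (x : R) : `|x| <= 1 / 2 -> `|expR x - 1 - x| <= 2 * x ^+ 2.
Proof.
rewrite ler_norml => /andP[x1 x2].
have h1 := expR_ge1Dx x; have h2 := expR_ge1Dx (- x).
have h3 := expRxMexpNx_1 x; have h4 := expR_gt0 x.
rewrite ler_norml; apply/andP; split; nra.
Qed.

Lemma sin_mvt (x : R) : exists2 c, `|c| <= `|x| & sin x = cos c * x.
Proof.
have pos (y : R) : 0 <= y -> exists2 c, `|c| <= `|y| & sin y = cos c * y.
  move=> y0.
  have [c] : exists2 c, c \in `[0, y] & sin y - sin 0 = cos c * (y - 0).
    apply: MVT_segment => //; apply: continuous_subspaceT; exact: continuous_sin.
  rewrite in_itv /= sin0 !subr0 => /andP[c0 cy] e.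
  by exists c => //; rewrite !ger0_norm.
have [/pos//|/ltW xn] := leP 0 x.
have [|c hc e] := pos (- x); first by rewrite oppr_ge0.
by exists c; rewrite -?[`|x|]normrN// -[LHS]opprK -sinN e mulrN opprK.
Qed.

Lemma sin_le (x : R) : `|sin x| <= `|x|.
Proof. by have [c _ ->] := sin_mvt x; rewrite normrM ler_piMl// cos_max. Qed.

Lemma cos_quad (x : R) : `|cos x - 1| <= x ^+ 2.
Proof.
have -> : cos x - 1 = - (2 * sin (x / 2) ^+ 2).
  have -> : cos x = cos ((x / 2) *+ 2) by congr cos; rewrite mulr2n; lra.
  by rewrite cos_mulr2n cos2sin2 [_ *+ 2]mulr2n; ring.
rewrite normrN normrM normrX normr_nat.
have : `|sin (x / 2)| ^+ 2 <= `|x / 2| ^+ 2.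
  by rewrite lerXn2r ?nnegrE// sin_le.
by rewrite [`|x / 2| ^+ 2]real_normK ?num_real// => ?; nra.
Qed.

(** By the mean value theorem sin x - x = (cos c - 1) x, and |cos c - 1| <= c^2 <= x^2 <= |x|. *)
Lemma sin_quad (x : R) : `|x| <= 1 -> `|sin x - x| <= x ^+ 2.
Proof.
move=> x1; have [c cx ->] := sin_mvt x.
rewrite -[X in _ - X]mul1r -mulrBl normrM -[x ^+ 2]real_normK ?num_real// expr2.
rewrite ler_wpM2r// (le_trans (cos_quad c))// -[c ^+ 2]real_normK ?num_real//.
have := normr_ge0 c; nra.
Qed.

Lemma cexp_quad0 (h : C) : nrm h <= 1 / 2 -> nrm (cexp h - 1 - h) <= 20 * nrm h ^+ 2.
Proof.
move=> h2; have := Re_le_nrm h; have := Im_le_nrm h; move: h2.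
move: (nrm h) => r h2 hb ha.
rewrite (le_trans (nrm_le_ReIm _))//.
move: ha hb; rewrite /cexp; case: h => a b /= ha hb; simpc; rewrite /=.
have e1 : `|expR a - 1 - a| <= 2 * a ^+ 2 by apply: expR_quad; lra.
have c1 := cos_quad b.
have s1 : `|sin b - b| <= b ^+ 2 by apply: sin_quad; lra.
have sq (u v : R) : `|u| <= v -> u ^+ 2 <= v ^+ 2.
  by move=> uv; rewrite -[u ^+ 2]real_normK ?num_real//; have := normr_ge0 u; nra.
have a2 := sq _ _ ha; have b2 := sq _ _ hb.
have ea : `|expR a - 1| <= 2 * r.
  rewrite -[X in `|X|](subrK a) (le_trans (ler_normD _ _))//.
  by have := normr_ge0 a; nra.
have r0 : 0 <= r by rewrite (le_trans _ ha).
have ea2 : `|expR a| <= 2.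
  by rewrite -[X in `|X|](subrK 1) (le_trans (ler_normD _ _))// normr1; lra.
(* Each of the four summands of the real and imaginary parts is at most 2 r^2; the constant 20 is
   not sharp. *)
have re : expR a * cos b - 1 - a = (expR a - 1 - a) + expR a * (cos b - 1) by ring.
have im : expR a * sin b - b = expR a * (sin b - b) + (expR a - 1) * b by ring.
rewrite re im.
have m1 : `|expR a * (cos b - 1)| <= 2 * r ^+ 2.
  by rewrite normrM ler_pM// (le_trans c1).
have m2 : `|expR a * (sin b - b)| <= 2 * r ^+ 2.
  by rewrite normrM ler_pM// (le_trans s1).
have m3 : `|(expR a - 1) * b| <= 2 * r * r by rewrite normrM ler_pM.
have := ler_normD (expR a - 1 - a) (expR a * (cos b - 1)).
have := ler_normD (expR a * (sin b - b)) ((expR a - 1) * b).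
nra.
Qed.

Lemma cexp_bounds (k : R) : 0 <= k -> exists K : R, 0 < K /\ forall z w : C,
  nrm z <= k -> nrm w <= k ->
  [/\ nrm (cexp z) <= K, nrm (cexp w - cexp z) <= K * nrm (w - z) &
      nrm (cexp w - cexp z - (w - z) * cexp z) <= K * nrm (w - z) ^+ 2].
Proof.
move=> k0; have E0 := expR_gt0 k; set E := expR k in E0.
have hE z : nrm z <= k -> nrm (cexp z) <= E.
  move=> zk; rewrite nrm_cexp ler_expR (le_trans (ler_norm _))//.
  exact: le_trans (Re_le_nrm z) zk.
have quad (z w : C) : nrm z <= k -> nrm w <= k ->
    nrm (cexp w - cexp z - (w - z) * cexp z) <= (30 * E) * nrm (w - z) ^+ 2.
  move=> zk wk; have n0 := nrm_ge0 (w - z).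
  have [h|h] := leP (nrm (w - z)) (1 / 2).
    have -> : cexp w - cexp z - (w - z) * cexp z =
        (cexp (w - z) - 1 - (w - z)) * cexp z.
      by rewrite !mulrBl mul1r -cexpD subrK.
    rewrite nrmM mulrC -!mulrA mulrCA.
    rewrite (le_trans (ler_pM (nrm_ge0 _) (nrm_ge0 _) (hE _ zk) (cexp_quad0 h)))//.
    by have := sqr_ge0 (nrm (w - z)); nra.
  (* For a distance d > 1/2 crude bounds on the three terms suffice, since 1 <= 4 d^2 and d <= 2
     d^2. *)
  rewrite (le_trans (nrmB _ _))// (le_trans (lerD (nrmB _ _) (lexx _)))// nrmM.
  have m : nrm (w - z) * nrm (cexp z) <= nrm (w - z) * E by rewrite ler_wpM2l ?hE.
  have a1 := hE _ wk; have a2 := hE _ zk.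
  have : nrm (w - z) * E <= 2 * nrm (w - z) ^+ 2 * E by rewrite ler_pM2r//; nra.
  have : 1 * E <= 4 * nrm (w - z) ^+ 2 * E by rewrite ler_pM2r//; nra.
  have : 0 <= nrm (w - z) ^+ 2 * E by rewrite mulr_ge0 ?sqr_ge0// ltW.
  by rewrite mul1r -!mulrA (mulrC E); lra.
(* As d <= 2k, the remainder 30 E d^2 is also at most 60 E k d, which gives the Lipschitz bound. *)
exists (31 * E + 60 * E * k); split; first by nra.
move=> z w zk wk; have n0 := nrm_ge0 (w - z).
have n2 : nrm (w - z) <= k + k by rewrite (le_trans (nrmB _ _))// lerD.
have q := quad _ _ zk wk; have Ek : 0 <= E * k by nra.
split.
- by rewrite (le_trans (hE _ zk))//; nra.
- rewrite -[X in nrm X](subrK ((w - z) * cexp z)) (le_trans (nrmD _ _))//.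
  have m : nrm ((w - z) * cexp z) <= nrm (w - z) * E.
    by rewrite nrmM ler_wpM2l ?hE.
  have : nrm (w - z) ^+ 2 <= (k + k) * nrm (w - z) by rewrite expr2 ler_wpM2r.
  by have E0' := ltW E0; move=> /(ler_wpM2l E0'); nra.
- by rewrite (le_trans q)// ler_wpM2r ?sqr_ge0//; lra.
Qed.

End ComplexExp.

Section ExpMap.
Context {R : realType} {a b : nat}.
Notation C := (Cplx R).
Variables P Q S : 'M[C]_(a, b).

(** One class serves both directions: S = 0 gives the Horn-Kapranov map, while an S of rank one adds
    the transverse direction that makes the Jacobian square. *)
Definition expmap (x : 'rV[C]_a) : 'rV[C]_b :=
  \row_k ((x *m P) 0 k * cexp ((x *m Q) 0 k) + (x *m S) 0 k).

Definition expmap_jac (x : 'rV[C]_a) : 'M[C]_(a, b) :=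
  (P + Q *m diag_mx (x *m P)) *m diag_mx (\row_k cexp ((x *m Q) 0 k)) + S.

Lemma expmapE x k :
  expmap x 0 k = (x *m P) 0 k * cexp ((x *m Q) 0 k) + (x *m S) 0 k.
Proof. by rewrite mxE. Qed.

Lemma expmap_jacE x (h : 'rV_a) k : (h *m expmap_jac x) 0 k =
  ((h *m P) 0 k + (h *m Q) 0 k * (x *m P) 0 k) * cexp ((x *m Q) 0 k)
  + (h *m S) 0 k.
Proof.
have diagE (y d : 'rV[C]_b) : (y *m diag_mx d) 0 k = y 0 k * d 0 k.
  by rewrite mul_mx_diag mxE.
rewrite mulmxDr [LHS]mxE; congr (_ + _).
rewrite mulmxA diagE [(\row_(_ < _) _) _ _]mxE; congr (_ * _).
by rewrite mulmxDr mulmxA [LHS]mxE diagE.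
Qed.

Lemma expmap_bounds (k : R) : 0 <= k -> exists K : R, 0 < K /\ forall x y,
  nrm x <= k -> nrm y <= k ->
  nrm (expmap y - expmap x - (y - x) *m expmap_jac x) <= K * nrm (y - x) ^+ 2 /\
  forall h : 'rV_a, nrm (h *m expmap_jac x) <= K * nrm h /\
    nrm (h *m (expmap_jac y - expmap_jac x)) <= K * nrm h * nrm (y - x).
Proof.
move=> k0.
have [c [c0 hP hQ hS]] : exists c : R, [/\ 0 < c,
    forall x : 'rV_a, nrm (x *m P) <= c * nrm x,
    forall x : 'rV_a, nrm (x *m Q) <= c * nrm x &
    forall x : 'rV_a, nrm (x *m S) <= c * nrm x].
  have [c1 [? h1]] := nrm_mulmx_ex P; have [c2 [? h2]] := nrm_mulmx_ex Q.
  have [c3 [? h3]] := nrm_mulmx_ex S.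
  exists (c1 + c2 + c3); split; first lra.
  - by move=> x; rewrite (le_trans (h1 _ x))// ler_wpM2r ?nrm_ge0//; lra.
  - by move=> x; rewrite (le_trans (h2 _ x))// ler_wpM2r ?nrm_ge0//; lra.
  - by move=> x; rewrite (le_trans (h3 _ x))// ler_wpM2r ?nrm_ge0//; lra.
have coord (M : 'M[C]_(a, b)) (hM : forall x : 'rV_a, nrm (x *m M) <= c * nrm x)
    (x : 'rV_a) l r : nrm x <= r -> nrm ((x *m M) 0 l) <= c * r.
  move=> xr; rewrite (le_trans (nrm_coord _ _ _))// (le_trans (hM x))//.
  by rewrite ler_wpM2l// ltW.
have ck0 : 0 <= c * k by rewrite mulr_ge0// ltW.
have [E [E0 hE]] := cexp_bounds ck0.
(* K1 bounds the Taylor remainder, K2 the derivative and K3 its variation; c bounds P, Q and S, and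
   E controls the exponential on the disc of radius c k. *)
pose K1 := c * E * c + c * k * (E * c ^+ 2).
pose K2 := (c + c * (c * k)) * E + c.
pose K3 := c * (E * c) + c * ((c * k) * (E * c) + c * E).
have K10 : 0 <= K1 by rewrite addr_ge0// ?mulr_ge0 ?exprn_ge0//; lra.
have K20 : 0 < K2 by rewrite ltr_wpDl// mulr_ge0 ?addr_ge0 ?mulr_ge0//; lra.
have K30 : 0 <= K3 by rewrite ?addr_ge0 ?mulr_ge0 ?addr_ge0 ?mulr_ge0//; lra.
exists (K1 + K2 + K3); split; first lra.
move=> x y xk yk; have d0 := nrm_ge0 (y - x).
have hEl l := hE ((x *m Q) 0 l) ((y *m Q) 0 l) (coord _ hQ _ _ _ xk) (coord _ hQ _ _ _ yk).
have dQ l : nrm ((y *m Q) 0 l - (x *m Q) 0 l) <= c * nrm (y - x).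
  by have := coord _ hQ (y - x) l _ (lexx _); rewrite mulmxBl !mxE.
have dP l : nrm ((y *m P) 0 l - (x *m P) 0 l) <= c * nrm (y - x).
  by have := coord _ hP (y - x) l _ (lexx _); rewrite mulmxBl !mxE.
have dE l : nrm (cexp ((y *m Q) 0 l) - cexp ((x *m Q) 0 l)) <= E * (c * nrm (y - x)).
  by have [_ h _] := hEl l; rewrite (le_trans h)// ler_wpM2l// ltW.
split; [|move=> h; have h0 := nrm_ge0 h; split].
- rewrite (@le_trans _ _ (K1 * nrm (y - x) ^+ 2))//; last first.
    by rewrite ler_wpM2r ?sqr_ge0//; lra.
  apply: nrm_mx_le => [|i l]; first by rewrite mulr_ge0 ?sqr_ge0.
  have [_ _ qE] := hEl l; rewrite ord1 {i}.
  (* The linear part cancels; what remains is a product of two increments plus p(x) times the Taylor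
     remainder of the exponential, both quadratic. *)
  have -> : (expmap y - expmap x - (y - x) *m expmap_jac x) 0 l =
    ((y *m P) 0 l - (x *m P) 0 l) * (cexp ((y *m Q) 0 l) - cexp ((x *m Q) 0 l))
    + (x *m P) 0 l * (cexp ((y *m Q) 0 l) - cexp ((x *m Q) 0 l)
      - ((y *m Q) 0 l - (x *m Q) 0 l) * cexp ((x *m Q) 0 l)).
    rewrite mxE [X in _ + X]mxE expmap_jacE mxE [X in _ + X - _]mxE !expmapE.
    by rewrite !mulmxBl !(mxE, mxE) /=; ring.
  rewrite (le_trans (nrmD _ _))// !nrmM.
  have -> : K1 * nrm (y - x) ^+ 2 = (c * nrm (y - x)) * (E * (c * nrm (y - x)))
      + c * k * (E * (c * nrm (y - x)) ^+ 2) by rewrite /K1; ring.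
  rewrite lerD// ler_pM ?nrm_ge0//; first exact: coord.
  rewrite (le_trans qE)// ler_wpM2l ?(ltW E0)// lerXn2r ?nnegrE ?nrm_ge0//.
  by rewrite mulr_ge0// ltW.
- rewrite (@le_trans _ _ (K2 * nrm h))//; last first.
    by rewrite ler_wpM2r//; lra.
  apply: nrm_mx_le => [|i l]; first by rewrite mulr_ge0// ltW.
  have [bE _ _] := hEl l; rewrite ord1 {i} expmap_jacE.
  rewrite (le_trans (nrmD _ _))//.
  have -> : K2 * nrm h = (c * nrm h + c * nrm h * (c * k)) * E + c * nrm h.
    by rewrite /K2; ring.
  rewrite lerD// ?coord// nrmM ler_pM ?nrm_ge0// (le_trans (nrmD _ _))//.
  by rewrite lerD ?coord// nrmM ler_pM ?nrm_ge0 ?coord.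
- rewrite (@le_trans _ _ (K3 * nrm h * nrm (y - x)))//; last first.
    by rewrite !ler_wpM2r//; lra.
  apply: nrm_mx_le => [|i l]; first by rewrite !mulr_ge0.
  have [bE _ _] := hEl l; rewrite ord1 {i}.
  have -> : (h *m (expmap_jac y - expmap_jac x)) 0 l =
     (h *m P) 0 l * (cexp ((y *m Q) 0 l) - cexp ((x *m Q) 0 l))
     + (h *m Q) 0 l * ((y *m P) 0 l * (cexp ((y *m Q) 0 l) - cexp ((x *m Q) 0 l))
     + ((y *m P) 0 l - (x *m P) 0 l) * cexp ((x *m Q) 0 l)).
    have mB (u v : 'rV[C]_b) : (u - v) 0 l = u 0 l - v 0 l by rewrite !mxE.
    have eJ z := expmap_jacE z h l.
    rewrite mulmxBr mB [X in X - _ = _]eJ [X in _ - X = _]eJ.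
    move: ((h *m P) 0 l) ((h *m Q) 0 l) ((h *m S) 0 l) => u1 u2 u3.
    move: ((y *m P) 0 l) ((x *m P) 0 l) => u4 u5.
    by move: (cexp _) (cexp _) => u6 u7; ring.
  have -> : K3 * nrm h * nrm (y - x) = (c * nrm h) * (E * (c * nrm (y - x)))
     + (c * nrm h) * ((c * k) * (E * (c * nrm (y - x))) + c * nrm (y - x) * E).
    by rewrite /K3; ring.
  rewrite (le_trans (nrmD _ _))// lerD// nrmM ler_pM ?nrm_ge0 ?coord//.
  by rewrite (le_trans (nrmD _ _))// lerD// nrmM ler_pM ?nrm_ge0 ?coord.
Qed.

End ExpMap.

(** * Inverse function theorem *)

Lemma exprn2_small (R : realType) (c e : R) : 0 < e -> exists n, c / 2 ^+ n < e.
Proof.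
move=> e0; have [c0|c0] := leP c 0.
  by exists 0%N; rewrite expr0 divr1 (le_lt_trans c0).
exists (Num.truncn (c / e)).+1; set n := Num.truncn _.
have h1 : c / e < n.+1%:R by apply: truncnS_gt.
have h2 : n.+1%:R <= 2 ^+ n.+1 :> R.
  by rewrite -natrX ler_nat ltnW// ltn_expl.
rewrite ltr_pdivrMr ?exprn_gt0// mulrC -ltr_pdivrMr//.
exact: lt_le_trans h2.
Qed.

(** T need not preserve the ball: a first step of at most s followed by halving keeps the iterates
    within 2s of x1. The radius 4s is where [geometric_cvg] locates the limit. *)
Lemma contraction_fixpoint (R : realType) p (T : 'rV[Cplx R]_p -> 'rV[Cplx R]_p)
    (x1 : 'rV[Cplx R]_p) (s : R) : 0 <= s ->
  (forall x y, nrm (x - x1) <= 4 * s -> nrm (y - x1) <= 4 * s ->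
     nrm (T x - T y) <= 1 / 2 * nrm (x - y)) ->
  nrm (T x1 - x1) <= s -> exists l, nrm (l - x1) <= 4 * s /\ T l = l.
Proof.
move=> s0 ctr hs; pose x n := iter n T x1.
have pw n : 0 < (2 : R) ^+ n by rewrite exprn_gt0.
have step n : nrm (x n - x1) <= 2 * s - 2 * s / 2 ^+ n /\
    nrm (x n.+1 - x n) <= s / 2 ^+ n.
  elim: n => [|n [ih1 ih2]].
    by rewrite subrr nrm0 expr0 !divr1 subrr.
  have e : 2 * s / 2 ^+ n.+1 = s / 2 ^+ n.
    by rewrite exprS invfM mulrA (mulrC 2) mulfK// pnatr_eq0.
  have e2 : 2 * s / 2 ^+ n = s / 2 ^+ n + s / 2 ^+ n.
    by rewrite -mulrA mulr_natl mulr2n.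
  have p1 : 0 <= s / 2 ^+ n by rewrite divr_ge0// ltW.
  have b1 : nrm (x n.+1 - x1) <= 2 * s - 2 * s / 2 ^+ n.+1.
    by rewrite (le_trans (nrm_tri (x n) _ _))//; rewrite e; lra.
  split=> //; rewrite (le_trans (ctr _ _ _ _))//; rewrite -/(x n) -/(x n.+1).
  - by rewrite (le_trans b1)//; rewrite e; lra.
  - by rewrite (le_trans ih1)//; lra.
  - have -> : s / 2 ^+ n.+1 = 1 / 2 * (s / 2 ^+ n).
      by rewrite exprS invfM; ring.
    by rewrite ler_wpM2l.
have [l hl] := geometric_cvg (fun n => (step n).2).
have lx1 : nrm (l - x1) <= 4 * s by have := hl 0; rewrite expr0 divr1.
exists l; split=> //; apply/eqP; rewrite -subr_eq0 -nrm_eq0 eq_le nrm_ge0 andbT.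
apply/ler_addgt0Pr => e e0; rewrite add0r.
have [n hn] := exprn2_small (8 * s) e0.
rewrite (le_trans _ (ltW hn))// (le_trans (nrm_tri (x n.+1) _ _))//.
have h1 : nrm (T l - x n.+1) <= 1 / 2 * nrm (l - x n).
  apply: ctr => //; rewrite (le_trans (step n).1)//.
  have : 0 <= 2 * s / 2 ^+ n by rewrite divr_ge0 ?(ltW (pw n))// mulr_ge0.
  by lra.
have h2 := hl n; have h3 := hl n.+1; rewrite (nrm_distC (x n.+1)).
have e2 : 4 * s / 2 ^+ n.+1 = 2 * (s / 2 ^+ n).
  rewrite exprS invfM -[4]/(2 * 2)%:R natrM; field.
  by rewrite gt_eqF.
have e1 : 4 * s / 2 ^+ n = 4 * (s / 2 ^+ n) by rewrite mulrA.
have e3 : 8 * s / 2 ^+ n = 8 * (s / 2 ^+ n) by rewrite mulrA.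
have p1 : 0 <= s / 2 ^+ n by rewrite divr_ge0// ltW.
by rewrite e1 in h2; rewrite e2 in h3; rewrite e3; lra.
Qed.

Section ExpMapDiff.
Context {R : realType}.
Notation C := (Cplx R).

Lemma expmap_diff a b (P Q S : 'M[C]_(a, b)) x :
  differentiable (expmap P Q S) x.
Proof.
have [K [K0 hK]] := @expmap_bounds _ _ _ P Q S (nrm x + 1) (addr_ge0 (nrm_ge0 _) ler01).
apply: (proj1 (diff_nrm (L := mulmxr (expmap_jac P Q S x)) _ _)).
  exact: mulmx_continuous.
move=> e e0; exists (Num.min 1 (e / K)); split.
  by rewrite lt_min ltr01 divr_gt0.
move=> h; rewrite lt_min => /andP[h1 h2].
have [||+ _] := hK x (h + x).
- lra.
- by rewrite (le_trans (nrmD _ _))//; lra.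
rewrite addrK => H; rewrite (le_trans H)// expr2 mulrA ler_wpM2r ?nrm_ge0//.
by rewrite mulrC -ler_pdivlMr// ltW.
Qed.

(** The inverse [phi], not the map itself, is the biholomorphism, because it will serve as the
    straightening chart of a hypersurface; [r] lets the source be shrunk. *)
Lemma expmap_local_inverse N (P Q S : 'M[C]_N) (x0 : 'rV[C]_N) (r : R) :
  0 < r -> expmap_jac P Q S x0 \in unitmx -> exists U V phi,
    [/\ V x0, biholomorphic U V phi, U = expmap P Q S @` V,
        forall x, V x -> phi (expmap P Q S x) = x &
        forall x, V x -> nrm (x - x0) < r].
Proof.
set F := expmap P Q S; set J := expmap_jac P Q S => r0 uM.
set M := J x0 in uM.
have [c [c0 hc]] := nrm_mulmx_ex (invmx M).
have [K [K0 hK]] := @expmap_bounds _ _ _ P Q S (nrm x0 + 1) (addr_ge0 (nrm_ge0 _) ler01).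
have Kc : 0 < K * c by rewrite mulr_gt0.
(* For x, y in the ball, F y - F x differs from (y - x) M by at most 3 K d |y - x|; the factor 6
   makes this 1/2 after applying the inverse of M. *)
have [d [d0 d1 dKc dr]] : exists d : R,
    [/\ 0 < d, d <= 1, 6 * (K * c) * d <= 1 & d <= r].
  exists (Num.min (Num.min 1 (6 * (K * c))^-1) r).
  have i0 : 0 < (6 * (K * c))^-1 by rewrite invr_gt0 mulr_gt0.
  split; rewrite ?lt_min ?ltr01 ?i0// ?ge_min ?lexx ?orbT//.
  by rewrite mulrC -ler_pdivlMr ?mulr_gt0// mul1r !ge_min lexx orbT.
pose V : set 'rV[C]_N := [set x | nrm (x - x0) < d].
have Vk x : V x -> nrm x <= nrm x0 + 1.
  move=> Vx; rewrite -[x in nrm x](subrK x0) (le_trans (nrmD _ _))// addrC lerD2l.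
  by rewrite (le_trans (ltW Vx)).
have k0 : nrm x0 <= nrm x0 + 1 by rewrite lerDl.
have JM x (v : 'rV[C]_N) : V x -> nrm (v *m J x *m invmx M - v) <= 1 / 2 * nrm v.
  move=> Vx; rewrite -[X in _ - X](mulmxK uM) -mulmxBl -mulmxBr (le_trans (hc _ _))//.
  have [_ /(_ v)[_ hv]] := hK _ _ k0 (Vk x Vx).
  rewrite (le_trans (ler_wpM2l (ltW c0) hv))//.
  have n0 := nrm_ge0 v; have : c * K * nrm (x - x0) <= 1 / 2.
    by rewrite (le_trans (ler_wpM2l _ (ltW Vx)))//; nra.
  by move=> /(ler_wpM2r n0); rewrite -!mulrA (mulrC (nrm v)).
have ctr x y : V x -> V y -> nrm ((F y - F x) *m invmx M - (y - x)) <= 1 / 2 * nrm (y - x).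
  move=> Vx Vy; rewrite -[X in _ - X](mulmxK uM) -mulmxBl (le_trans (hc _ _))//.
  have [h1 _] := hK _ _ (Vk x Vx) (Vk y Vy).
  have [_ /(_ (y - x))[_ h2]] := hK _ _ k0 (Vk x Vx).
  have -> : F y - F x - (y - x) *m M =
      (F y - F x - (y - x) *m J x) + (y - x) *m (J x - M).
    by rewrite mulmxBr addrA subrK.
  have yx2 : nrm (y - x) <= d + d.
    rewrite (le_trans (nrm_tri x0 _ _))// lerD ?(ltW Vy)// nrm_distC; exact: ltW.
  have n0 := nrm_ge0 (y - x); have n1 := nrm_ge0 (x - x0).
  have Vx' := ltW Vx; rewrite /V /= in Vx'.
  have : nrm ((F y - F x - (y - x) *m J x) + (y - x) *m (J x - M))
      <= (3 * K * d) * nrm (y - x).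
    rewrite (le_trans (nrmD _ _))//.
    have : K * nrm (y - x) ^+ 2 <= K * (nrm (y - x) * (d + d)).
      by rewrite ler_pM2l// expr2 ler_wpM2l.
    have : K * nrm (y - x) * nrm (x - x0) <= K * nrm (y - x) * d.
      by rewrite ler_wpM2l// mulr_ge0// ltW.
    lra.
  move=> /(ler_wpM2l (ltW c0)) /le_trans; apply.
  by rewrite mulrA ler_wpM2r//; nra.
have lip x y : V x -> V y -> nrm (y - x) <= 2 * c * nrm (F y - F x).
  move=> Vx Vy; have := ctr _ _ Vx Vy; have := hc _ (F y - F x).
  have := nrm_tri ((F y - F x) *m invmx M) (y - x) 0.
  by rewrite !subr0 nrm_distC; lra.
have Finj x y : V x -> V y -> F x = F y -> x = y.
  move=> Vx Vy e; have := lip _ _ Vx Vy; rewrite e subrr nrm0 mulr0.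
  by move=> /nrm_le0/eqP; rewrite subr_eq0 => /eqP.
have oV : open V.
  apply/open_nrmP => x Vx; exists (d - nrm (x - x0)); split.
    by rewrite subr_gt0.
  by move=> y yx; rewrite /V /= (le_lt_trans (nrm_tri x _ _))//; lra.
pose U := F @` V.
have oU : open U.
  apply/open_nrmP => _ [x1 Vx1 <-].
  pose r1 := d - nrm (x1 - x0); have r10 : 0 < r1 by rewrite subr_gt0.
  (* Then 4 c |u - F x1| < r1 / 2, so the ball of the fixed point argument stays in V. *)
  exists (r1 / (8 * c)); split; first by rewrite divr_gt0// mulr_gt0.
  move=> u; rewrite ltr_pdivlMr ?mulr_gt0// => uF.
  (* The simplified Newton map: its fixed points solve F x = u. *)
  pose T x := x - (F x - u) *m invmx M.
  have s0 : 0 <= c * nrm (u - F x1) by rewrite mulr_ge0 ?nrm_ge0// ltW.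
  have inV x : nrm (x - x1) <= 4 * (c * nrm (u - F x1)) -> V x.
    move=> h; rewrite /V /= (le_lt_trans (nrm_tri x1 _ _))//.
    by rewrite -ltrBrDr (le_lt_trans h)// -/r1; lra.
  have [||l [hl Tl]] := @contraction_fixpoint _ _ T x1 _ s0.
  - move=> x y /inV Vx /inV Vy; rewrite (le_trans _ (ctr _ _ Vy Vx))//.
    rewrite -nrmN; have -> // : - (T x - T y) = (F x - F y) *m invmx M - (x - y).
    have <- : (F x - u) *m invmx M - (F y - u) *m invmx M = (F x - F y) *m invmx M.
      by rewrite -mulmxBl opprB addrA subrK.
    rewrite /T; move: (_ *m _) (_ *m _) => v w.
    by apply/rowP => j; rewrite !mxE; ring.
  - have -> : T x1 - x1 = (u - F x1) *m invmx M.
      by rewrite /T addrAC subrr sub0r -mulNmx opprB.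
    exact: hc.
  exists l; first exact: inV.
  apply/eqP; rewrite -subr_eq0 -[X in X == _](mulmxKV uM).
  move/eqP: Tl; rewrite /T -subr_eq0 addrAC subrr sub0r oppr_eq0 => /eqP ->.
  by rewrite mul0mx.
pose phi u := xget 0 [set x | V x /\ F x = u].
have phiP u : U u -> V (phi u) /\ F (phi u) = u.
  by move=> [x Vx <-]; rewrite /phi; case: xgetP => [y _ //|/(_ x) []].
have phiF x : V x -> phi (F x) = x.
  by move=> Vx; have [|? ?] := phiP (F x); [exists x|exact: Finj].
exists U, V, phi; split => //; first by rewrite /V /= subrr nrm0.
  split => //.
  - apply/seteqP; split=> [_ [u Uu <-]|x Vx]; first exact: (phiP _ Uu).1.
    by exists (F x); [exists x|exact: phiF].
  - move=> _ [x Vx <-].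
    (* By [JM] a kernel vector v would satisfy |v| <= |v| / 2. *)
    have uJ : J x \in unitmx.
      rewrite -row_free_unit; apply: inj_row_free => v vJ.
      have := JM x v Vx; rewrite vJ mul0mx sub0r nrmN => ?.
      by apply: nrm_le0; lra.
    have [c' [c'0 hc']] := nrm_mulmx_ex (invmx (J x)).
    apply: (proj1 (diff_nrm (L := mulmxr (invmx (J x))) _ _)).
      exact: mulmx_continuous.
    move=> e e0; have [|d' [d'0 hd']] := iffLR (open_nrmP U) oU (F x); first by exists x.
    have A0 : 0 < c' * K * (2 * c) ^+ 2 by rewrite !mulr_gt0 ?exprn_gt0 ?mulr_gt0.
    exists (Num.min d' (e / (c' * K * (2 * c) ^+ 2))); split.
      by rewrite lt_min d'0 divr_gt0.
    move=> k; rewrite lt_min => /andP[k1]; rewrite ltr_pdivlMr// => k2.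
    have [|Vy Fy] := phiP (k + F x); first by apply: hd'; rewrite addrK.
    set y := phi (k + F x) in Vy Fy *; rewrite phiF//=.
    have hk : F y - F x = k by rewrite Fy addrK.
    have -> : y - x - k *m invmx (J x) = - ((F y - F x - (y - x) *m J x) *m invmx (J x)).
      by rewrite hk mulmxBl mulmxK// opprB.
    have h1 := lip _ _ Vx Vy; rewrite hk in h1.
    have [h2 _] := hK _ _ (Vk x Vx) (Vk y Vy).
    rewrite nrmN (le_trans (hc' _ _))// (le_trans (ler_wpM2l (ltW c'0) h2))//.
    have n0 := nrm_ge0 k.
    have h3 : nrm (y - x) ^+ 2 <= (2 * c * nrm k) ^+ 2.
      by rewrite lerXn2r ?nnegrE ?nrm_ge0// !mulr_ge0// ltW.
    rewrite (@le_trans _ _ (c' * (K * (2 * c * nrm k) ^+ 2)))//.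
      by rewrite ler_pM2l// ler_pM2l.
    have -> : c' * (K * (2 * c * nrm k) ^+ 2) = (nrm k * (c' * K * (2 * c) ^+ 2)) * nrm k.
      by ring.
    by rewrite ler_wpM2r// ltW.
  - exists F; split; first by move=> u Uu; exact: (phiP _ Uu).2.
    by move=> y _; exact: expmap_diff.
by move=> x Vx; exact: lt_le_trans Vx dr.
Qed.
End ExpMapDiff.

(** * Images of maps with singular differential *)

(** The index of the cell of width 1/s containing r, counted from -c. For |r| <= c and 2 c s <= n it
    is at most n, so [inord] does not alter it. *)
Definition grid_label (R : realType) (c s : R) (n : nat) (r : R) : 'I_n.+1 :=
  inord (Num.truncn ((r + c) * s)).

Lemma grid_label_close (R : realType) (c s : R) n (r r' : R) :
  0 < s -> 2 * c * s <= n%:R -> `|r| <= c -> `|r'| <= c ->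
  grid_label c s n r = grid_label c s n r' -> `|r - r'| <= s^-1.
Proof.
move=> s0 csn; rewrite !ler_norml => /andP[r1 r2] /andP[r3 r4].
have bnd (t : R) : - c <= t -> t <= c ->
    let j := Num.truncn ((t + c) * s) in
    [/\ (j < n.+1)%N, j%:R <= (t + c) * s & (t + c) * s < j%:R + 1].
  move=> t1 t2 /=; have t0 : 0 <= (t + c) * s by rewrite mulr_ge0 ?(ltW s0)//; lra.
  have h1 : (Num.truncn ((t + c) * s))%:R <= (t + c) * s by rewrite truncn_le.
  split => //; last by rewrite natr1; exact: truncnS_gt.
  rewrite ltnS -(ler_nat R) (le_trans h1)// (le_trans _ csn)// ler_wpM2r ?(ltW s0)//.
  by lra.
have [a1 a2 a3] := bnd _ r1 r2; have [b1 b2 b3] := bnd _ r3 r4.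
move=> /(congr1 (@nat_of_ord _)); rewrite /grid_label !inordK// => e; rewrite e in a2 a3.
apply/andP; split; rewrite -(ler_pM2r s0) ?mulNr mulVf ?gt_eqF//; lra.
Qed.

Definition grid_vec (R : realType) (c s : R) (n p : nat) (z : 'I_p -> Cplx R) :
    {ffun 'I_p -> 'I_n.+1 * 'I_n.+1} :=
  [ffun j => (grid_label c s n (complex.Re (z j)), grid_label c s n (complex.Im (z j)))].

Lemma grid_vec_close (R : realType) (c s : R) n p (z z' : 'I_p -> Cplx R) :
  0 < s -> 2 * c * s <= n%:R ->
  (forall j, nrm (z j) <= c) -> (forall j, nrm (z' j) <= c) ->
  grid_vec c s n z = grid_vec c s n z' ->
  forall j, nrm (z j - z' j) <= 2 / s.
Proof.
move=> s0 csn zc zc' /ffunP e j; have := e j; rewrite !ffunE => -[e1 e2].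
have h1 := grid_label_close s0 csn (le_trans (Re_le_nrm _) (zc j))
  (le_trans (Re_le_nrm _) (zc' j)) e1.
have h2 := grid_label_close s0 csn (le_trans (Im_le_nrm _) (zc j))
  (le_trans (Im_le_nrm _) (zc' j)) e2.
rewrite (le_trans (nrm_le_ReIm _))//.
move: h1 h2; case: (z j) => a b; case: (z' j) => a' b' /= h1 h2.
by rewrite (le_trans (lerD h1 h2))//; lra.
Qed.

(** Division by the largest coordinate gives a kernel vector that can clear its pivot coordinate
    from any vector while at most doubling the norm. *)
Lemma kernel_pivot (R : realType) p b (J : 'M[Cplx R]_(p, b)) (v : 'rV[Cplx R]_p) :
  v != 0 -> v *m J = 0 -> exists (w : 'rV[Cplx R]_p) i,
    [/\ w 0 i = 1, w *m J = 0 & nrm w <= 1].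
Proof.
move=> v0 vJ; have nv : 0 < nrm v by rewrite nrm_gt0.
have [i hi] : exists i, nrm v <= nrm (v 0 i).
  apply: contrapT => h; have : nrm v < nrm v.
    apply: nrm_mx_lt => // r j; rewrite ord1 ltNge; apply/negP => hj.
    by apply: h; exists j.
  by rewrite ltxx.
have vi : v 0 i != 0 by rewrite -nrm_gt0 (lt_le_trans nv).
exists ((v 0 i)^-1 *: v), i; split; first by rewrite mxE mulVf.
  by rewrite -scalemxAl vJ scaler0.
have e : nrm ((v 0 i)^-1) * nrm (v 0 i) = 1 by rewrite -nrmM mulVf// nrm1.
by rewrite nrmZ -e ler_wpM2l// nrm_ge0.
Qed.

Section Counting.
Context {R : realType} {d b : nat}.
Notation C := (Cplx R).
Variables P Q S : 'M[C]_(d.+1, b).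
Hypothesis singular : forall x, exists2 v : 'rV[C]_d.+1,
  v != 0 & v *m expmap_jac P Q S x = 0.
Notation F := (expmap P Q S).
Notation J := (expmap_jac P Q S).

(* On a cube of side 1/M, F varies to first order only along a complement of a
   kernel direction; cutting that complement into cells of side 1/M^2 leaves
   one factor M^2 fewer labels than the M^4 per complex coordinate that
   M^-2-separated values would need. *)
Lemma expmap_pigeonhole (k : nat) : exists K : R, 0 < K /\
  forall (M : nat) (I : finType) (x : I -> 'rV[C]_d.+1), (0 < M)%N ->
    (forall a, nrm (x a) <= k%:R) ->
    (((2 * k * M).+1 ^ 2) ^ d.+1 * ((8 * M).+1 ^ 2) ^ d < #|I|)%N ->
    exists a a', a != a' /\ nrm (F (x a) - F (x a')) <= K / M%:R ^+ 2.
Proof.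
have [K [K0 hK]] := @expmap_bounds _ _ _ P Q S k%:R (ler0n _ _).
(* Two Taylor remainders over distance 2/M cost 4K each, and the fine cell costs 2K, all over
   M^2. *)
exists (10 * K); split; first lra.
move=> M I x M0 xk hI.
have M0' : 0 < M%:R :> R by rewrite ltr0n.
have /choice[vi hvi] : forall y : 'rV[C]_d.+1, exists wi : 'rV[C]_d.+1 * 'I_d.+1,
    [/\ wi.1 0 wi.2 = 1, wi.1 *m J y = 0 & nrm wi.1 <= 1].
  move=> y; have [v v0 vJ] := singular y.
  by have [w [i h]] := kernel_pivot v0 vJ; exists (w, i).
pose l1 a := grid_vec k%:R M%:R (2 * k * M) (fun j => x a 0 j).
(* A representative of the coarse cell of [a]. The pick always succeeds, so it depends on the cell
   alone; base point, kernel vector and pivot are thus shared by the whole cell. *)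
pose r a := odflt a [pick a' | l1 a' == l1 a].
have l1r a : l1 (r a) = l1 a.
  by rewrite /r; case: pickP => [a' /eqP//|/(_ a)]; rewrite eqxx.
have rE a a' : l1 a = l1 a' -> r a = r a'.
  by move=> e; rewrite /r e; case: pickP => // /(_ a'); rewrite eqxx.
have xr a : nrm (x a - x (r a)) <= 2 / M%:R.
  apply: nrm_mx_le => [|j0 j]; first by rewrite divr_ge0.
  rewrite ord1 !mxE.
  apply: (@grid_vec_close _ k%:R M%:R (2 * k * M) _ (fun j => x a 0 j)
    (fun j => x (r a) 0 j)) => //.
  - by rewrite !natrM.
  - by move=> j'; rewrite (le_trans (nrm_coord _ _ _)).
  - by move=> j'; rewrite (le_trans (nrm_coord _ _ _)).
  - by apply/esym; exact: (l1r a).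
pose v a := (vi (x (r a))).1; pose piv a := (vi (x (r a))).2.
(* The displacement moved along the kernel: same first-order image, but zero pivot coordinate. *)
pose z a := (x a - x (r a)) - (x a - x (r a)) 0 (piv a) *: v a.
have zi a : z a 0 (piv a) = 0.
  have [e _ _] := hvi (x (r a)); rewrite /z /v /piv !mxE e.
  by rewrite mulr1 subrr.
have zJ a : z a *m J (x (r a)) = (x a - x (r a)) *m J (x (r a)).
  have [_ e _] := hvi (x (r a)).
  by rewrite mulmxBl -scalemxAl e scaler0 subr0.
have zn a : nrm (z a) <= 4 / M%:R.
  have [_ _ e] := hvi (x (r a)).
  rewrite (le_trans (nrmB _ _))// nrmZ.
  have -> : 4 / M%:R = 2 / M%:R + (2 / M%:R) * 1 :> R by rewrite mulr1; lra.
  by rewrite lerD// ler_pM ?nrm_ge0// (le_trans (nrm_coord _ _ _)).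
(* Only the d coordinates off the pivot are labelled; cells of width 1/M^2 over a range of 8/M
   number about 8M. *)
pose l2 a := grid_vec (4 / M%:R) (M%:R ^+ 2) (8 * M) (fun j => z a 0 (lift (piv a) j)).
pose l a := (l1 a, l2 a).
have [a [a' [ne e]]] : exists a a', a != a' /\ l a = l a'.
  apply: contrapT => h; move: hI; apply/negP; rewrite -leqNgt.
  have linj : injective l.
    move=> a a' e; apply/eqP/negP => /negP ne; apply: h; exists a, a'; by split.
  by rewrite (leq_trans (leq_card _ linj))// card_prod !card_ffun !card_prod !card_ord.
move: e => [e1 e2]; exists a, a'; split=> //.
have er := rE _ _ e1.
have zz : nrm (z a - z a') <= 2 / M%:R ^+ 2.
  apply: nrm_mx_le => [|j0 j]; first by rewrite divr_ge0.
  rewrite ord1 (_ : (z a - z a') 0 j = z a 0 j - z a' 0 j); last by rewrite !mxE.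
  have [->|ij] := eqVneq j (piv a).
    have ei : piv a = piv a' by rewrite /piv er.
    by rewrite zi ei zi subr0 nrm0 divr_ge0.
  move: ij; rewrite eq_sym => /unlift_some[j' -> _].
  have := grid_vec_close _ _ _ _ e2.
  have -> : piv a' = piv a by rewrite /piv er.
  apply.
  - by rewrite exprn_gt0.
  - by rewrite natrM -subr_ge0 le_eqVlt; apply/orP; left; apply/eqP; field; rewrite gt_eqF.
  - by move=> j1; rewrite (le_trans (nrm_coord _ _ _)).
  - by move=> j1; rewrite (le_trans (nrm_coord _ _ _)).
have Ea c : nrm (F (x c) - F (x (r c)) - (x c - x (r c)) *m J (x (r c))) <= K * (2 / M%:R) ^+ 2.
  have [h _] := hK (x (r c)) (x c) (xk _) (xk _); rewrite (le_trans h)//.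
  by rewrite ler_pM2l// lerXn2r ?nnegrE ?nrm_ge0// divr_ge0.
have zzJ : nrm ((z a - z a') *m J (x (r a))) <= K * (2 / M%:R ^+ 2).
  have [_ /(_ (z a - z a'))[h _]] := hK (x (r a)) (x (r a)) (xk _) (xk _).
  by rewrite (le_trans h)// ler_pM2l.
have Ea' := Ea a'; rewrite -er in Ea'.
have zJ' := zJ a'; rewrite -er in zJ'.
have -> : F (x a) - F (x a') =
   (F (x a) - F (x (r a)) - (x a - x (r a)) *m J (x (r a)))
   - (F (x a') - F (x (r a)) - (x a' - x (r a)) *m J (x (r a)))
   + (z a - z a') *m J (x (r a)).
  rewrite (_ : (z a - z a') *m J (x (r a)) =
      (x a - x (r a)) *m J (x (r a)) - (x a' - x (r a)) *m J (x (r a))); last first.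
    by rewrite mulmxBl; exact: (f_equal2 (fun u w => u - w) (zJ a) zJ').
  move: (F _) (F _) (F _) (_ *m _) (_ *m _) => A1 A2 A3 A4 A5.
  by apply/rowP => j; rewrite !mxE; ring.
have -> : 10 * K / M%:R ^+ 2 = K * (2 / M%:R) ^+ 2 + K * (2 / M%:R) ^+ 2 + K * (2 / M%:R ^+ 2).
  by field; rewrite gt_eqF.
apply: (le_trans (nrmD _ _)); apply: (lerD _ zzJ).
by apply: (le_trans (nrmB _ _)); exact: (lerD (Ea a) Ea').
Qed.

(** In s the left side has degree 4d + 2 and the right side 4d + 4, so a large s works for any fixed
    q; [A] is the ratio of the constants after square roots. *)
Lemma counting_gap (k : nat) (q : nat) : (0 < q)%N -> exists s, (0 < s)%N /\
  (((2 * k * (q * s)).+1 ^ 2) ^ d.+1 * ((8 * (q * s)).+1 ^ 2) ^ d <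
   ((q * s ^ 2) ^ 2) ^ d.+1)%N.
Proof.
move=> q0; pose A := ((2 * k).+1 ^ d.+1 * (9 ^ d * q ^ d))%N.
exists A.+1; split=> //; set s := A.+1.
have qs0 : (0 < q * s)%N by rewrite muln_gt0 q0.
rewrite ![((_ ^ 2) ^ _)%N]expnAC -expnMn ltn_exp2r//.
apply: (@leq_ltn_trans (((2 * k).+1 * (q * s)) ^ d.+1 * (9 * (q * s)) ^ d)).
  apply: leq_mul; first by rewrite leq_exp2r// mulSn -add1n leq_add.
  by case: (d) => // d'; rewrite leq_exp2r// ltn_pmul2r.
have -> : (((2 * k).+1 * (q * s)) ^ d.+1 * (9 * (q * s)) ^ d = q ^ d.+1 * s ^ d.+1 * s ^ d * A)%N.
  by rewrite /A !expnMn; ring.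
have -> : ((q * s ^ 2) ^ d.+1 = q ^ d.+1 * s ^ d.+1 * s ^ d * s)%N.
  by rewrite expnMn -expnM mul2n -addnn expnD [in X in (_ * (_ * X))%N]expnS; ring.
by rewrite ltn_pmul2l// !muln_gt0 !expn_gt0 q0.
Qed.

(** If the parameters y came close to every point of a fine grid, two of them would have nearly
    equal values of F, hence by the Lipschitz bound be closer than the grid spacing allows. The
    avoided ball lies well inside the given one, in the form needed for nested balls. *)
Lemma expmap_nowhere_denseS (rel : 'rV[C]_d.+1 -> 'rV[C]_d.+1 -> Prop) (k : nat)
    (c eta : R) : 0 < c -> 0 < eta ->
  (forall y x, rel y x -> nrm x <= k%:R) ->
  (forall y x y' x', rel y x -> rel y' x' -> nrm (F x - F x') <= eta ->
     nrm (y - y') <= c * nrm (F x - F x')) ->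
  forall (y0 : 'rV[C]_d.+1) (rho : R), 0 < rho -> exists y1 rho1,
    [/\ 0 < rho1, nrm (y1 - y0) + rho1 <= rho / 2 &
        forall y x, rel y x -> ~ nrm (y - y1) < rho1].
Proof.
move=> c0 eta0 relk rellip y0 rho rho0; apply: contrapT => dense.
have [K [K0 hK]] := expmap_pigeonhole k.
(* The first summand will give c K / M^2 < u / 2 with u = rho / (8 L), the second K / M^2 <= eta;
   both use M^2 = q L. *)
pose q := (Num.truncn (16 * c * K / rho + K / eta)).+1.
have q1 : 16 * c * K / rho + K / eta < q%:R by apply: truncnS_gt.
have A1 : 0 < 16 * c * K / rho by rewrite divr_gt0// !mulr_gt0.
have A2 : 0 < K / eta by rewrite divr_gt0.
have [s [s0 gap]] := @counting_gap k q isT.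
pose M := (q * s)%N; pose L := (q * s ^ 2)%N.
have L0 : (0 < L)%N by rewrite muln_gt0 expn_gt0 s0.
have L0' : 0 < L%:R :> R by rewrite ltr0n.
have L1 : 1 <= L%:R :> R by rewrite ler1n.
have M2 : M%:R ^+ 2 = q%:R * L%:R :> R by rewrite /M /L !natrM; ring.
pose u := rho / (8 * L%:R).
have u0 : 0 < u by rewrite divr_gt0// mulr_gt0.
have uL : u * L%:R = rho / 8 by rewrite /u; field; rewrite gt_eqF.
pose I := {ffun 'I_d.+1 -> 'I_L * 'I_L}.
pose pt (f : I) : 'rV[C]_d.+1 :=
  y0 + \row_j ((u * ((f j).1 : nat)%:R) +i* (u * ((f j).2 : nat)%:R))%C.
have pt0 f : nrm (pt f - y0) <= rho / 4.
  rewrite /pt addrAC subrr add0r.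
  apply: nrm_mx_le => [|i j]; first by rewrite divr_ge0// ltW.
  rewrite mxE (le_trans (nrm_le_ReIm _))//=.
  have bd (t : 'I_L) : `|u * (t : nat)%:R| <= rho / 8.
    by rewrite normrM gtr0_norm// normr_nat -uL ler_pM2l// ler_nat ltnW.
  by rewrite (le_trans (lerD (bd _) (bd _)))//; lra.
have sep f f' : f != f' -> u <= nrm (pt f - pt f').
  move=> ne; have [j hj] : exists j, f j != f' j.
    apply: contrapT => h; move/eqP: ne; apply; apply/ffunP => j.
    by apply/eqP/negP => /negP hj; apply: h; exists j.
  rewrite (le_trans _ (nrm_coord _ 0 j))//.
  rewrite /pt opprD addrACA subrr add0r !mxE.
  have nat1 (p p' : nat) : p != p' -> u <= `|u * p%:R - u * p'%:R|.
    move=> pp; rewrite -mulrBr normrM gtr0_norm// ler_pMr//.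
    rewrite -[p%:R]/(p%:Z%:~R) -[p'%:R]/(p'%:Z%:~R) -intrB -intr_norm.
    rewrite -[1]/(1%:~R) ler_int -gtz0_ge1 normr_gt0 subr_eq0 eqz_nat.
    exact: pp.
  have [e1|ne1] := eqVneq (f j).1 (f' j).1.
    have ne2 : (f j).2 != (f' j).2.
      by apply: contra hj => /eqP e2; apply/eqP; case: (f j) (f' j) e1 e2 => ? ? [? ?] /= -> ->.
    by rewrite (le_trans _ (Im_le_nrm _))//=; apply: nat1.
  by rewrite (le_trans _ (Re_le_nrm _))//=; apply: nat1.
have /choice[yx hyx] : forall f : I, exists yx : 'rV[C]_d.+1 * 'rV[C]_d.+1,
    rel yx.1 yx.2 /\ nrm (yx.1 - pt f) < u / 4.
  (* Errors of u/4 at both ends leave a separation of u/2 between parameters of distinct grid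
     points. *)
  move=> f; apply: contrapT => h; apply: dense; exists (pt f), (u / 4); split.
  - by rewrite divr_gt0.
  - have : u <= rho / 8 by rewrite -uL ler_peMr// ltW.
    by have := pt0 f; lra.
  - by move=> y x yx hy; apply: h; exists (y, x).
have [|||f [f' [ne hff]]] := hK M I (fun f => (yx f).2).
- by rewrite muln_gt0.
- by move=> f; have [h _] := hyx f; exact: relk h.
- by rewrite card_ffun card_prod !card_ord.
have [h1 h2] := hyx f; have [h3 h4] := hyx f'.
have KM : K / M%:R ^+ 2 <= eta.
  rewrite ler_pdivrMr ?exprn_gt0 ?ltr0n ?muln_gt0// M2 mulrC -ler_pdivrMr//.
  rewrite (@le_trans _ _ q%:R)//; last by rewrite ler_peMr.
  by rewrite (le_trans _ (ltW q1))// lerDr ltW.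
have h5 := rellip _ _ _ _ h1 h3 (le_trans hff KM).
have h6 := sep _ _ ne.
have h7 : nrm (pt f - pt f') <=
    nrm ((yx f).1 - pt f) + (nrm ((yx f).1 - (yx f').1) + nrm ((yx f').1 - pt f')).
  rewrite (le_trans (nrm_tri (yx f).1 _ _))// [in leLHS]nrm_distC lerD2l.
  exact: nrm_tri.
have h8 : u / 2 <= c * (K / M%:R ^+ 2).
  by rewrite (@le_trans _ _ (c * nrm (F (yx f).2 - F (yx f').2)))//; [lra|rewrite ler_pM2l].
have : 16 * c * K / rho * (u * L%:R) < q%:R * (u * L%:R).
  by rewrite (ltr_pM2r (mulr_gt0 u0 L0')) (lt_trans _ q1)// ltrDl.
rewrite uL; have -> : 16 * c * K / rho * (rho / 8) = 2 * (c * K).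
  by field; rewrite gt_eqF.
have : u / 2 * (q%:R * L%:R) <= c * K.
  rewrite -M2 -ler_pdivlMr ?exprn_gt0 ?ltr0n ?muln_gt0//.
  by rewrite -(mulrA c).
have -> : u / 2 * (q%:R * L%:R) = q%:R * (u * L%:R) / 2 by ring.
by rewrite uL; lra.
Qed.

End Counting.

Lemma expmap_nowhere_dense (R : realType) (p b : nat) (P Q S : 'M[Cplx R]_(p, b))
    (rel : 'rV[Cplx R]_p -> 'rV[Cplx R]_p -> Prop) (k : nat) (c eta : R) :
  (0 < p)%N ->
  (forall x, exists2 v : 'rV[Cplx R]_p, v != 0 & v *m expmap_jac P Q S x = 0) ->
  0 < c -> 0 < eta ->
  (forall y x, rel y x -> nrm x <= k%:R) ->
  (forall y x y' x', rel y x -> rel y' x' ->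
     nrm (expmap P Q S x - expmap P Q S x') <= eta ->
     nrm (y - y') <= c * nrm (expmap P Q S x - expmap P Q S x')) ->
  forall (y0 : 'rV[Cplx R]_p) (rho : R), 0 < rho -> exists y1 rho1,
    [/\ 0 < rho1, nrm (y1 - y0) + rho1 <= rho / 2 &
        forall y x, rel y x -> ~ nrm (y - y1) < rho1].
Proof.
case: p P Q S rel => // d P Q S rel _ sing.
exact: expmap_nowhere_denseS.
Qed.

(** The Baire argument with nested balls. Radii at least halve, so the centres converge
    geometrically, and later centres stay within half the radius, which puts the limit inside every
    open ball. *)
Lemma baire_nrm (R : realType) p (E : nat -> set 'rV[Cplx R]_p) :
  (forall n (y0 : 'rV[Cplx R]_p) (rho : R), 0 < rho -> exists y1 rho1,
    [/\ 0 < rho1, nrm (y1 - y0) + rho1 <= rho / 2 &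
        forall y, E n y -> ~ nrm (y - y1) < rho1]) ->
  forall (y0 : 'rV[Cplx R]_p) (rho : R), 0 < rho ->
  exists l, nrm (l - y0) < rho /\ forall n, ~ E n l.
Proof.
move=> h y0 rho rho0.
have /choice[st hst] : forall a : nat * ('rV[Cplx R]_p * R), exists b : 'rV[Cplx R]_p * R,
    0 < a.2.2 -> [/\ 0 < b.2, nrm (b.1 - a.2.1) + b.2 <= a.2.2 / 2 &
        forall y, E a.1 y -> ~ nrm (y - b.1) < b.2].
  move=> [n [y r]] /=; have [r0|r0] := ltP 0 r; last by exists (y, r).
  by have [y1 [r1 H]] := h n y r r0; exists (y1, r1).
pose B := fix B n := if n is n'.+1 then st (n', B n') else (y0, rho).
have Bpos n : 0 < (B n).2.
  by elim: n => // n ih; have [] := hst (n, B n) ih.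
have Bst n := hst (n, B n) (Bpos n).
have nest n j : nrm ((B (n + j)%N).1 - (B n).1) + (B (n + j)%N).2 <= (B n).2.
  elim: j => [|j ih]; first by rewrite addn0 subrr nrm0 add0r.
  rewrite addnS; have [_ e _] := Bst (n + j)%N; rewrite /= in e *.
  have := nrm_tri (B (n + j)%N).1 (st ((n + j)%N, B (n + j)%N)).1 (B n).1.
  have := Bpos (n + j)%N; lra.
have half n j : nrm ((B (n + j.+1)%N).1 - (B n).1) <= (B n).2 / 2.
  have [_ e _] := Bst n; have := nest n.+1 j; rewrite addSnnS.
  have := nrm_tri (B n.+1).1 (B (n + j.+1)%N).1 (B n).1.
  have := Bpos (n + j.+1)%N; rewrite /= in e *; lra.
have Bsmall n : (B n).2 <= rho / 2 ^+ n.
  elim: n => [|n ih]; first by rewrite expr0 divr1.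
  have [_ e _] := Bst n; have n0 := nrm_ge0 ((B n.+1).1 - (B n).1).
  have -> : rho / 2 ^+ n.+1 = (rho / 2 ^+ n) / 2 by rewrite exprS invfM; ring.
  rewrite /= in e n0 *; lra.
have [|l hl] := @geometric_cvg _ _ (fun n => (B n).1) rho.
  move=> n; rewrite (le_trans _ (Bsmall n))//.
  have := half n 0%N; rewrite addn1; have := Bpos n; lra.
have lin n : nrm (l - (B n).1) < (B n).2.
  have [|j hj] := @exprn2_small _ (4 * rho) ((B n).2 / 2); first by rewrite divr_gt0.
  have h1 := hl (n + j.+1)%N; have h2 := half n j.
  have h3 : 4 * rho / 2 ^+ (n + j.+1) <= 4 * rho / 2 ^+ j.
    rewrite ler_pM2l ?mulr_gt0// lef_pV2 ?posrE ?exprn_gt0//.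
    by rewrite ler_weXn2l ?ler1n//; lia.
  rewrite (le_lt_trans (nrm_tri (B (n + j.+1)%N).1 _ _))//; lra.
exists l; split; first exact: lin 0%N.
by move=> n En; have [_ _ /(_ l En)] := Bst n; apply; exact: lin n.+1.
Qed.

(** * Polynomials and determinants *)

Lemma digits_inj (m D : nat) (a b : 'I_m -> nat) :
  (forall i, (a i < D)%N) -> (forall i, (b i < D)%N) ->
  (\sum_i a i * D ^ i = \sum_i b i * D ^ i)%N -> a =1 b.
Proof.
elim: m a b => [|m IH] a b aD bD; first by move=> _ [].
have e (c : 'I_m.+1 -> nat) :
    (\sum_i c i * D ^ i = (\sum_(i < m) c (lift ord0 i) * D ^ i) * D + c ord0)%N.
  rewrite big_ord_recl expn0 muln1 addnC big_distrl; congr (_ + _)%N.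
  by apply: eq_bigr => i _; rewrite lift0 expnSr mulnA.
rewrite !e => h.
have D0 : (0 < D)%N by apply: leq_trans (aD ord0).
have e0 : a ord0 = b ord0.
  by have /(congr1 (modn^~ D)) := h; rewrite !modnMDl !modn_small.
have es : (\sum_(i < m) a (lift ord0 i) * D ^ i = \sum_(i < m) b (lift ord0 i) * D ^ i)%N.
  by move: h; rewrite e0 => /addIn/eqP; rewrite eqn_pmul2r// => /eqP.
move=> i; case: (unliftP ord0 i) => [j ->|->//].
by apply: (IH (fun j => a (lift ord0 j)) (fun j => b (lift ord0 j))).
Qed.

(* Kronecker substitution t_i = x^(D^i), with D above the degree, keeps distinct
   monomials distinct and so reduces to one variable. *)
Lemma mpoly_nonvanishing (F : numFieldType) m (p : mpoly.mpoly m F) :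
  p != 0 -> exists v : 'I_m -> F, mpoly.meval v p != 0.
Proof.
move=> p0; pose D := (\max_(mm <- mpoly.msupp p) mpoly.mdeg mm).+1.
pose kap (mm : mpoly.multinom m) := (\sum_i mm i * D ^ i)%N.
have mmD mm : mm \in mpoly.msupp p -> forall i, (mm i < D)%N.
  move=> mmp i; rewrite ltnS; apply: (@leq_trans (mpoly.mdeg mm)); last exact: leq_bigmax_seq.
  by rewrite mpoly.mdegE (bigD1 i)//= leq_addr.
pose q : {poly F} := \sum_(mm <- mpoly.msupp p) mpoly.mcoeff mm p *: 'X^(kap mm).
have qE x : q.[x] = mpoly.meval (fun i => x ^+ (D ^ i)) p.
  rewrite mpoly.mevalE horner_sum; apply: eq_bigr => mm _.
  rewrite hornerZ hornerXn; congr (_ * _).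
  rewrite expr_sum; apply: eq_bigr => i _.
  by rewrite -exprM mulnC.
have q0 : q != 0.
  have [m0 m0p] : exists m0, m0 \in mpoly.msupp p.
    case E : (mpoly.msupp p) => [|m0 s]; last by exists m0; rewrite inE eqxx.
    by move/eqP: E; rewrite mpoly.msupp_eq0 (negbTE p0).
  apply/eqP => /(congr1 (fun r : {poly F} => r`_(kap m0))).
  rewrite coef0 coef_sum (bigD1_seq m0)//= ?mpoly.msupp_uniq// coefZ coefXn eqxx mulr1.
  rewrite big_seq_cond big1 ?addr0; last first.
    move=> mm /andP[mmp ne]; rewrite coefZ coefXn.
    case: eqP => [e|]; last by rewrite mulr0.
    case/eqP: ne; apply/mpoly.mnmP.
    exact: (digits_inj (mmD _ mmp) (mmD _ m0p) (esym e)).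
  by move/eqP; rewrite mpoly.mcoeff_eq0 m0p.
(* The first [size q] natural numbers are distinct in characteristic 0, too many to be all roots. *)
have [x hx] : exists x, q.[x] != 0.
  apply: contrapT => h; have := @max_poly_roots _ q [seq k%:R | k <- iota 0 (size q)] q0.
  rewrite size_map size_iota ltnn => H; suff: false by [].
  apply: H.
    apply/allP => _ /mapP[k _ ->]; apply/rootP/eqP/negPn/negP => hk.
    by apply: h; exists k%:R.
  rewrite map_inj_uniq ?iota_uniq// => a b /eqP; rewrite eqr_nat => /eqP//.
by exists (fun i => x ^+ (D ^ i)); rewrite -qE.
Qed.

Section CauchyBinet.
Context {K : comNzRingType} {n N : nat}.

Lemma det_mulmx_sum (X : 'M[K]_(n, N)) (Y : 'M[K]_(N, n)) :
  \det (X *m Y) =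
  \sum_(f : {ffun 'I_n -> 'I_N}) (\prod_i X i (f i)) * \det (rowsub f Y).
Proof.
rewrite /determinant.
under eq_bigr => s _.
  rewrite (eq_bigr (fun i => \sum_j X i j * Y j (s i))); last by move=> i _; rewrite mxE.
  rewrite bigA_distr_bigA big_distrr /=.
  over.
rewrite exchange_big /=; apply: eq_bigr => f _.
rewrite big_distrr /=; apply: eq_bigr => s _.
rewrite big_split /= mulrCA; congr (_ * (_ * _)).
by apply: eq_bigr => i _; rewrite mxE.
Qed.

Lemma det_rowsub_perm (s : 'S_n) (f : 'I_n -> 'I_N) (Y : 'M[K]_(N, n)) :
  \det (rowsub (f \o s) Y) = (-1) ^+ s * \det (rowsub f Y).
Proof.
rewrite (_ : rowsub (f \o s) Y = row_perm s (rowsub f Y)).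
  by rewrite row_permE det_mulmx det_perm.
by apply/matrixP => i j; rewrite !mxE.
Qed.

Definition subset_enum (sigma : subsets n N) (j : 'I_n) : 'I_N :=
  enum_val (cast_ord (esym (eqP (valP sigma))) j).

Lemma subset_enum_inj sigma : injective (subset_enum sigma).
Proof. by move=> i j /enum_val_inj/cast_ord_inj. Qed.

Lemma subset_enum_im (sigma : subsets n N) :
  subset_enum sigma @: 'I_n = val sigma.
Proof.
apply/eqP; rewrite eqEcard; apply/andP; split.
  by apply/fintype.subsetP => _ /imsetP[j _ ->]; exact: enum_valP.
by rewrite card_imset ?card_ord; [rewrite (eqP (valP sigma))|exact: subset_enum_inj].
Qed.

(** Every injection factors uniquely as a permutation of its source followed by the increasing
    enumeration of its image. *)
Lemma sum_injections (G : {ffun 'I_n -> 'I_N} -> K) :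
  (forall f : {ffun 'I_n -> 'I_N}, ~~ injectiveb f -> G f = 0) ->
  \sum_f G f = \sum_(sigma : subsets n N) \sum_(s : 'S_n)
    G [ffun i => subset_enum sigma (s i)].
Proof.
move=> G0.
rewrite (bigID (fun f => injectiveb (f : {ffun _ -> _})))/= [X in _ + X]big1 ?addr0//.
rewrite (partition_big (fun f : {ffun 'I_n -> 'I_N} => f @: 'I_n)
  (fun sigma => #|sigma| == n))/=; last first.
  by move=> f /injectiveP fi; rewrite card_imset// card_ord.
rewrite (reindex_omap (val : subsets n N -> _) insub)/=; last first.
  by move=> sg h; rewrite insubT.
rewrite (eq_bigl xpredT)/=; last first.
  by move=> sg; rewrite valK eqxx andbT (valP sg).
apply: eq_bigr => sg _.
pose h (s : 'S_n) := [ffun i => subset_enum sg (s i)].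
have hinj : injective h.
  move=> s s' /ffunP e; apply/permP => i; have := e i.
  by rewrite !ffunE => /subset_enum_inj.
rewrite (reindex_omap h (fun f => [pick s | h s == f]))/=; last first.
  move=> f /andP[/injectiveP fi /eqP fim].
  case: pickP => [s /eqP/= ->//|none].
  have ex (i : 'I_n) : exists j, subset_enum sg j == f i.
    have fim' : f @: 'I_n = subset_enum sg @: 'I_n.
      by rewrite subset_enum_im; exact: fim.
    have : f i \in f @: 'I_n by apply: imset_f.
    by rewrite fim' => /imsetP[j _ ->]; exists j.
  pose g i := xchoose (ex i).
  have gE i : subset_enum sg (g i) = f i by apply/eqP; exact: (xchooseP (ex i)).
  have gi : injective g by move=> i j e; apply: fi; rewrite -!gE e.
  have := none (perm gi); suff -> : h (perm gi) = f by rewrite eqxx.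
  by apply/ffunP => i; rewrite ffunE permE gE.
apply: eq_bigl => s; apply/andP; split; [apply/andP; split|].
- by apply/injectiveP => i j; rewrite !ffunE => /subset_enum_inj/perm_inj.
- rewrite -[X in _ == X]subset_enum_im; apply/eqP/setP => k; apply/imsetP/imsetP.
    by move=> [j _ ->]; exists (s j) => //; rewrite ffunE.
  by move=> [j _ ->]; exists (s^-1%g j) => //; rewrite ffunE permKV.
- by case: pickP => [s' /eqP/hinj ->//|/(_ s)]; rewrite eqxx.
Qed.

(** Maps with a repeated value select equal rows of Y and contribute nothing. For a fixed image, the
    signs and products over all permutations reassemble the minor of X. *)
Lemma cauchy_binet (X : 'M[K]_(n, N)) (Y : 'M[K]_(N, n)) :
  \det (X *m Y) = \sum_(sigma : subsets n N)
    \det (colsub (subset_enum sigma) X) * \det (rowsub (subset_enum sigma) Y).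
Proof.
rewrite det_mulmx_sum sum_injections => [|f]; last first.
  move=> /injectivePn[i [j ij fij]]; rewrite (determinant_alternate ij) ?mulr0//.
  by move=> k; rewrite !mxE fij.
apply: eq_bigr => sg _.
rewrite [X in X * _]/determinant big_distrl /=; apply: eq_bigr => s _.
rewrite (_ : rowsub _ Y = rowsub (subset_enum sg \o s) Y); last first.
  by apply/matrixP => i j; rewrite !mxE ffunE.
rewrite det_rowsub_perm mulrCA mulrA; congr (_ * _ * _).
by apply: eq_bigr => i _; rewrite ffunE mxE.
Qed.

End CauchyBinet.

(** * The Horn-Kapranov parametrization *)

Lemma derive_nrm (R : realType) (V W : normedModType (Cplx R)) (f : V -> W) a v l
    (K d : R) : 0 < d -> 0 < K ->
  (forall h : Cplx R, nrm h < d ->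
     nrm (f (h *: v + a) - f a - h *: l) <= K * nrm h ^+ 2) ->
  'D_v f a = l.
Proof.
move=> d0 K0 H; apply/cvg_lim; first exact: norm_hausdorff.
move=> O /nbhs_nrmP[e [e0 he]]; apply/nbhs_nrmP.
exists (Num.min d (e / K)); split; first by rewrite lt_min d0 divr_gt0.
move=> h; rewrite subr0 lt_min => /andP[hd]; rewrite ltr_pdivlMr// => hK h0.
apply: he => /=.
have -> : h^-1 *: (f (h *: v + a) - f a) - l = h^-1 *: (f (h *: v + a) - f a - h *: l).
  by rewrite [RHS]scalerBr scalerA mulVf// scale1r.
have nh : 0 < nrm h by rewrite nrm_gt0.
have e1 : nrm h^-1 * nrm h = 1 by rewrite -nrmM mulVf// nrm1.
rewrite nrmZ (le_lt_trans (ler_wpM2l (nrm_ge0 _) (H h hd)))//.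
have -> : nrm h^-1 * (K * nrm h ^+ 2) = nrm h^-1 * nrm h * (nrm h * K) by ring.
by rewrite e1 mul1r.
Qed.

Section HornKapranov.
Context {R : realType} {n m : nat}.
Notation C := (Cplx R).
Notation N := (m + n).+1.
Variables (A : 'M[R]_(n.+1, N)) (B : 'M[C]_(N, m)).
Hypotheses (hA : point_configuration A) (hB : gale_dual A B).
Notation Ac := (map_mx (@toC R) A).
Notation Ah := (map_mx (@toC R) (hat A)).

(** The row space of B^T lies in this kernel, and both have dimension N - (n + 1) = m. *)
Lemma gale_kernel (c : 'rV[C]_N) : c *m Ac^T = 0 -> exists t, c = t *m B^T.
Proof.
have [rA _] := hA; have [rB AB] := hB.
move=> /eqP; rewrite -sub_kermx => cK.
have BK : (B^T <= kermx Ac^T)%MS.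
  by apply/sub_kermxP; rewrite -trmx_mul AB trmx0.
have rk : \rank (kermx Ac^T) = \rank B^T.
  by rewrite mxrank_ker !mxrank_tr mxrank_map rA rB subSS addnK.
have := mxrank_leqif_sup BK; rewrite rk => -[_]; rewrite eqxx => /esym KB.
by have /submxP[t ->] := submx_trans cK KB; exists t.
Qed.

Lemma config_mul0 (c : 'rV[C]_N) :
  c *m Ac^T = 0 <-> \sum_k c 0 k = 0 /\ c *m Ah^T = 0.
Proof.
have [_ A1] := hA.
have e0 : (c *m Ac^T) 0 ord0 = \sum_k c 0 k.
  by rewrite mxE; apply: eq_bigr => k _; rewrite !mxE A1 rmorph1 mulr1.
have eS j : (c *m Ac^T) 0 (lift ord0 j) = (c *m Ah^T) 0 j.
  by rewrite !mxE; apply: eq_bigr => k _; rewrite !mxE.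
split=> [h|[h0 hS]].
  split; first by rewrite -e0 h mxE.
  by apply/rowP => j; rewrite -eS h !mxE.
apply/rowP => j; rewrite [RHS]mxE; case: (unliftP ord0 j) => [i ->|->].
  by rewrite eS hS mxE.
by rewrite e0.
Qed.

Lemma gale_config (t : 'rV[C]_m) : t *m B^T *m Ac^T = 0.
Proof. by have [_ AB] := hB; rewrite -mulmxA -trmx_mul AB trmx0 mulmx0. Qed.

(** The Hessian at w = 0 of the exponential sum with coefficients <beta_k, t> and exponents the
    columns of hat A. *)
Definition hess (t : 'rV[C]_m) : 'M[C]_n := Ah *m diag_mx (t *m B^T) *m Ah^T.

Lemma linear_form_eval (t : 'rV[C]_m) k :
  mpoly.meval (fun i => t 0 i) (linear_form B k) = (t *m B^T) 0 k.
Proof.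
rewrite raddf_sum mxE; apply: eq_bigr => i _.
by rewrite /= mpoly.mevalZ mpoly.mevalXU mxE mulrC.
Qed.

Lemma det_hess (t : 'rV[C]_m) :
  \det (hess t) = mpoly.meval (fun i => t 0 i) (cuspidal_form A B).
Proof.
rewrite /hess cauchy_binet raddf_sum; apply: eq_bigr => sg _ /=.
rewrite mpoly.mevalZ rmorph_prod /=.
rewrite (eq_bigr (fun k => (t *m B^T) 0 k)); last by move=> k _; exact: linear_form_eval.
have minorE : \det (colsub (subset_enum sg) Ah) = toC (minor (hat A) sg).
  rewrite /minor -[RHS]det_map_mx; congr (\det _).
  by apply/matrixP => i j; rewrite !mxE.
have -> : rowsub (subset_enum sg) Ah^T = (colsub (subset_enum sg) Ah)^T.
  by apply/matrixP => i j; rewrite !mxE.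
have -> : colsub (subset_enum sg) (Ah *m diag_mx (t *m B^T)) =
    colsub (subset_enum sg) Ah *m diag_mx (\row_j (t *m B^T) 0 (subset_enum sg j)).
  by rewrite !mul_mx_diag; apply/matrixP => i j; rewrite !mxE.
rewrite det_mulmx det_tr det_diag minorE rmorphXn /= expr2 mulrAC; congr (_ * _).
rewrite -subset_enum_im big_imset /=; last by move=> i j _ _; exact: subset_enum_inj.
by apply: eq_bigr => j _; rewrite mxE.
Qed.

Definition horn_P : 'M[C]_(m + n, N) := col_mx B^T 0.
Definition horn_Q : 'M[C]_(m + n, N) := col_mx 0 Ah.

(* The map G above. *)
Definition horn : 'rV[C]_(m + n) -> 'rV[C]_N := expmap horn_P horn_Q 0.
Definition horn_jac := expmap_jac horn_P horn_Q 0.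

Lemma mul_horn_P (t : 'rV[C]_m) (w : 'rV[C]_n) : row_mx t w *m horn_P = t *m B^T.
Proof. by rewrite mul_row_col mulmx0 addr0. Qed.

Lemma mul_horn_Q (t : 'rV[C]_m) (w : 'rV[C]_n) : row_mx t w *m horn_Q = w *m Ah.
Proof. by rewrite mul_row_col mulmx0 add0r. Qed.

Lemma hornE (t : 'rV[C]_m) (w : 'rV[C]_n) k :
  horn (row_mx t w) 0 k = (t *m B^T) 0 k * cexp ((w *m Ah) 0 k).
Proof. by rewrite expmapE mul_horn_P mul_horn_Q mulmx0 [X in _ + X]mxE addr0. Qed.

(** Column k of the Jacobian carries the nonzero factor e^<w, hat alpha_k>, which drops out; the
    kernel is independent of w. *)
Lemma horn_jac_ker (t s : 'rV[C]_m) (w u : 'rV[C]_n) :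
  row_mx s u *m horn_jac (row_mx t w) = 0 <->
  s *m B^T + u *m Ah *m diag_mx (t *m B^T) = 0.
Proof.
have e k : (row_mx s u *m horn_jac (row_mx t w)) 0 k =
    (s *m B^T + u *m Ah *m diag_mx (t *m B^T)) 0 k * cexp ((w *m Ah) 0 k).
  transitivity (((s *m B^T) 0 k + (u *m Ah) 0 k * (t *m B^T) 0 k) * cexp ((w *m Ah) 0 k)).
    by rewrite expmap_jacE !mul_horn_P !mul_horn_Q mulmx0 [X in _ + X = _]mxE addr0.
  by congr (_ * _); rewrite mul_mx_diag [RHS]mxE; congr (_ + _); rewrite [RHS]mxE.
have z0 k : (0 : 'rV[C]_N) 0 k = 0 by rewrite mxE.
split=> h; apply/rowP => k; have := e k; rewrite h z0.
  move=> /esym/eqP.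
  by rewrite mulf_eq0 (negbTE (cexp_neq0 _)) orbF => /eqP.
by rewrite mul0r => ->.
Qed.

(** For u in the kernel of the Hessian, the vector u hat A diag(<beta_k, t>) is killed by hat A^T.
    Its entries sum to zero because hat A kills (<beta_k, t>)_k. Gale duality thus writes it as s
    B^T, and (-s, u) is the kernel vector. *)
Lemma horn_jac_singular (t : 'rV[C]_m) (w : 'rV[C]_n) : \det (hess t) = 0 ->
  exists2 v : 'rV[C]_(m + n), v != 0 & v *m horn_jac (row_mx t w) = 0.
Proof.
move=> /eqP/det0P[u u0 uH].
have : u *m Ah *m diag_mx (t *m B^T) *m Ac^T = 0.
  apply/config_mul0; split; last by rewrite -uH /hess !mulmxA.
  have /config_mul0[_ hS] := gale_config t.
  have -> : \sum_k (u *m Ah *m diag_mx (t *m B^T)) 0 k = (u *m (t *m B^T *m Ah^T)^T) 0 0.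
    rewrite trmx_mul trmxK mulmxA mul_mx_diag mxE; apply: eq_bigr => k _.
    by rewrite [LHS]mxE [X in _ = _ * X]mxE.
  by rewrite hS trmx0 mulmx0 mxE.
move=> /gale_kernel[s hs].
exists (row_mx (- s) u).
  by apply: contra u0 => /eqP e; have := row_mxKr (- s) u; rewrite e linear0 => <-.
by apply/horn_jac_ker; rewrite hs mulNmx addNr.
Qed.

(** Multiplying the kernel equation by hat A^T kills s B^T and leaves u times the Hessian. *)
Lemma horn_jac_free (t : 'rV[C]_m) (w : 'rV[C]_n) : \det (hess t) != 0 ->
  row_free (horn_jac (row_mx t w)).
Proof.
move=> dH; apply: inj_row_free => v.
rewrite -(hsubmxK v); move: (lsubmx v) (rsubmx v) => s u.
move=> /horn_jac_ker h.
have /config_mul0[_ sB] := gale_config s.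
have uH : u *m hess t = 0.
  move/(congr1 (mulmx^~ Ah^T)): h; rewrite mulmxDl sB add0r mul0mx.
  by rewrite /hess !mulmxA.
have u0 : u = 0.
  have uu : hess t \in unitmx by rewrite unitmxE unitfE.
  by rewrite -(mulmxK uu u) uH mul0mx.
move: h; rewrite u0 !mul0mx addr0 => sB0.
have Bf : row_free B^T by have [rB _] := hB; rewrite /row_free mxrank_tr rB.
have -> : s = 0 by apply: (row_free_inj Bf); rewrite sB0 mul0mx.
by rewrite row_mx0.
Qed.

(* If beta_k = 0 then the k-th coordinate vector is A^T u for some u not
   proportional to e_0, and the lower part of u lies in the kernel of the Hessian. *)
Lemma hess_zero_row k (t : 'rV[C]_m) : (0 < m + n)%N -> row k B = 0 -> \det (hess t) = 0.
Proof.
move=> mn0 Bk; apply/eqP/det0P.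
have [rA A1] := hA; have [rB AB] := hB.
have : (delta_mx 0 k : 'rV[C]_N) *m B = 0 by rewrite -rowE.
move=> /(congr1 trmx); rewrite trmx_mul trmx0 => kB.
have AK : (Ac <= kermx B)%MS by apply/sub_kermxP.
have rk : \rank (kermx B) = \rank Ac.
  rewrite mxrank_ker mxrank_map rA rB; lia.
have := mxrank_leqif_sup AK; rewrite rk => -[_]; rewrite eqxx => /esym KA.
have kK : ((delta_mx 0 k : 'rV[C]_N) <= kermx B)%MS.
  by apply/sub_kermxP; rewrite -rowE.
have /submxP[u hu] := submx_trans kK KA.
pose u' : 'rV[C]_n := \row_j u 0 (lift ord0 j).
have uE (j : 'I_N) : (u' *m Ah) 0 j = (j == k)%:R - u 0 ord0.
  have := congr1 (fun M : 'rV[C]_N => M 0 j) hu; rewrite !mxE big_ord_recl /=.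
  rewrite !mxE A1 rmorph1 mulr1 => ->.
  rewrite addrAC subrr add0r; apply: eq_bigr => i _.
  by rewrite !mxE.
exists u'.
  (* If u' were zero, column k would force u_0 = 1 and any other column u_0 = 0; another column
     exists since N >= 2. *)
  apply/eqP => u0; have uE0 j := uE j; rewrite u0 mul0mx in uE0.
  have := uE0 k; rewrite mxE eqxx => /eqP; rewrite eq_sym subr_eq0 => /eqP e1.
  have [j jk] : exists j : 'I_N, j != k.
    have [->|k0] := eqVneq k ord0; first by exists ord_max; rewrite -val_eqE /= -lt0n.
    by exists ord0; rewrite eq_sym.
  have := uE0 j; rewrite mxE (negbTE jk) -e1 sub0r => /eqP.
  by rewrite eq_sym oppr_eq0 oner_eq0.
have tk : (t *m B^T) 0 k = 0.
  rewrite mxE big1// => i _; rewrite mxE.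
  by have := congr1 (fun M : 'rV[C]_m => M 0 i) Bk; rewrite !mxE => ->; rewrite mulr0.
have e : u' *m Ah *m diag_mx (t *m B^T) = - u 0 ord0 *: (t *m B^T).
  apply/rowP => j; rewrite mul_mx_diag mxE [RHS]mxE uE.
  have [->|_] := eqVneq j k; first by rewrite tk !mulr0.
  by rewrite sub0r.
rewrite /hess !mulmxA e -scalemxAl.
by have /config_mul0[_ ->] := gale_config t; rewrite scaler0.
Qed.

Lemma exp_sum_derive (c : 'rV[C]_N) (w : 'rV[C]_n.+1) j :
  'D_(delta_mx ord0 j) (exp_sum A c) w =
  \sum_k c ord0 k * (toC (A j k) * cexp ((w *m Ac) 0 k)).
Proof.
have fE y : exp_sum A c y = \sum_k c ord0 k * cexp ((y *m Ac) 0 k).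
  apply: eq_bigr => k _; congr (_ * cexp _).
  by rewrite mxE; apply: eq_bigr => i _; rewrite mxE.
have [a [a0 ha]] := nrm_mulmx_ex Ac.
pose r := a * (nrm w + nrm (delta_mx ord0 j : 'rV[C]_n.+1)).
have r0 : 0 <= r by rewrite mulr_ge0 ?addr_ge0 ?nrm_ge0// ltW.
have [K [K0 hK]] := cexp_bounds r0.
pose S := \sum_k nrm (c ord0 k) * (K * nrm (toC (A j k) : C) ^+ 2).
have S0 : 0 <= S.
  by apply: sumr_ge0 => k _; rewrite !mulr_ge0 ?nrm_ge0 ?sqr_ge0// ltW.
apply: (@derive_nrm _ _ _ _ _ _ _ (S + 1) 1) => //; first lra.
move=> h h1; rewrite !fE.
have eh k : ((h *: delta_mx ord0 j + w) *m Ac) 0 k = (w *m Ac) 0 k + h * toC (A j k).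
  by rewrite mulmxDl -scalemxAl -rowE mxE addrC !mxE.
have -> : \sum_k c ord0 k * cexp (((h *: delta_mx ord0 j + w) *m Ac) 0 k)
    - \sum_k c ord0 k * cexp ((w *m Ac) 0 k)
    - h *: \sum_k c ord0 k * (toC (A j k) * cexp ((w *m Ac) 0 k)) =
  \sum_k c ord0 k * (cexp ((w *m Ac) 0 k + h * toC (A j k)) - cexp ((w *m Ac) 0 k)
    - h * toC (A j k) * cexp ((w *m Ac) 0 k)).
  rewrite scaler_sumr -!sumrB; apply: eq_bigr => k _; rewrite eh.
  by rewrite /GRing.scale /=; ring.
rewrite (le_trans (nrm_sum _ _ _))//.
rewrite (@le_trans _ _ (S * nrm h ^+ 2))//; last by rewrite ler_wpM2r ?sqr_ge0//; lra.
rewrite mulr_suml ler_sum// => k _; rewrite nrmM -[leRHS]mulrA ler_wpM2l ?nrm_ge0//.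
have bnd y : nrm y <= nrm w + nrm (delta_mx ord0 j : 'rV[C]_n.+1) -> nrm ((y *m Ac) 0 k) <= r.
  by move=> hy; rewrite (le_trans (nrm_coord _ _ _))// (le_trans (ha _ _))// ler_pM2l.
have [||_ _] := hK ((w *m Ac) 0 k) ((w *m Ac) 0 k + h * toC (A j k)).
- by apply: bnd; rewrite lerDl nrm_ge0.
- rewrite -eh; apply: bnd; rewrite (le_trans (nrmD _ _))// addrC lerD2l nrmZ.
  by rewrite ler_piMl ?nrm_ge0// ltW.
have -> : (w *m Ac) 0 k + h * toC (A j k) - (w *m Ac) 0 k = h * toC (A j k).
  by rewrite addrAC subrr add0r.
move=> H; rewrite (le_trans H)// nrmM.
by rewrite le_eqVlt; apply/orP; left; apply/eqP; ring.
Qed.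

Lemma dual_varietyP (c : 'rV[C]_N) :
  dual_variety A c <-> torus c /\ exists x, c = horn x.
Proof.
have [_ A1] := hA.
(* The vector of terms of the sum at w. Its product with the row of ones of A is both the value and
   the first partial derivative. *)
pose g (w : 'rV[C]_n.+1) : 'rV[C]_N := \row_k (c ord0 k * cexp ((w *m Ac) 0 k)).
have sing w : singular_point (exp_sum A c) w <-> g w *m Ac^T = 0.
  have f0 : exp_sum A c w = (g w *m Ac^T) 0 ord0.
    rewrite [RHS]mxE; apply: eq_bigr => k _; rewrite !mxE A1 rmorph1 mulr1.
    by congr (_ * cexp _); apply: eq_bigr => i _; rewrite mxE.
  have fj j : 'D_(delta_mx ord0 j) (exp_sum A c) w = (g w *m Ac^T) 0 j.
    rewrite exp_sum_derive [RHS]mxE; apply: eq_bigr => k _.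
    by rewrite [(g w) _ _]mxE [Ac^T _ _]mxE [Ac _ _]mxE; ring.
  rewrite /singular_point f0; split=> [[_ h]|h].
    by apply/rowP => j; rewrite -fj h mxE.
  by split=> [|j]; rewrite ?fj h mxE.
have wE (w : 'rV[C]_n.+1) k :
    (w *m Ac) 0 k = w 0 ord0 + ((\row_j w 0 (lift ord0 j)) *m Ah) 0 k.
  rewrite mxE big_ord_recl mxE A1 rmorph1 mulr1 mxE; congr (_ + _).
  by apply: eq_bigr => i _; rewrite !mxE.
split=> [[Tc [w /sing/gale_kernel[t ht]]]|[Tc [x xE]]]; split => //.
- pose w' : 'rV[C]_n := \row_j w 0 (lift ord0 j).
  exists (row_mx (cexp (- w 0 ord0) *: t) (- w')); apply/rowP => k.
  rewrite hornE -scalemxAl -ht.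
  have -> : (cexp (- w 0 ord0) *: g w) 0 k =
      cexp (- w 0 ord0) * (c 0 k * cexp (w 0 ord0 + (w' *m Ah) 0 k)).
    by rewrite [LHS]mxE; congr (_ * _); rewrite [LHS]mxE wE.
  have -> : (- w' *m Ah) 0 k = - (w' *m Ah) 0 k by rewrite mulNmx [LHS]mxE.
  rewrite cexpD.
  have e1 := cexpNz (w 0 ord0); have e2 := cexpNz ((w' *m Ah) 0 k).
  transitivity (c 0 k * (cexp (w 0 ord0) * cexp (- w 0 ord0))
    * (cexp ((w' *m Ah) 0 k) * cexp (- (w' *m Ah) 0 k))).
    by rewrite e1 e2 !mulr1.
  by ring.
(* The singular point has first coordinate 0 and undoes the exponentials of [horn x]. *)
- exists (\row_j if unlift ord0 j is Some i then - (rsubmx x) 0 i else 0).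
  set w := \row_j _; apply/sing.
  suff -> : g w = lsubmx x *m B^T by exact: gale_config.
  apply/rowP => k; rewrite mxE wE mxE unlift_none add0r.
  have -> : \row_j w 0 (lift ord0 j) = - rsubmx x.
    by apply/rowP => j; rewrite !mxE liftK !mxE.
  have -> : (- rsubmx x *m Ah) 0 k = - (rsubmx x *m Ah) 0 k by rewrite mulNmx [LHS]mxE.
  rewrite xE -[x in horn x]hsubmxK hornE.
  by rewrite -mulrA cexpNz mulr1.
Qed.

End HornKapranov.

(** * Hypersurfaces in the dual variety *)

Section Main.
Context {R : realType} {n m : nat}.
Notation C := (Cplx R).
Notation N := (m + n).+1.
Variables (A : 'M[R]_(n.+1, N)) (B : 'M[C]_(N, m)).
Hypotheses (hA : point_configuration A) (hB : gale_dual A B).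

(** E embeds C^(N-1) as the hyperplane of vanishing last coordinate, the model of a hypersurface
    chart; E' forgets that coordinate. *)
Let E : 'M[C]_(m + n, N) := pid_mx (m + n).
Let E' : 'M[C]_(N, m + n) := pid_mx (m + n).

Let EE' : E *m E' = 1%:M.
Proof. by rewrite mul_pid_mx minnn (minn_idPr (leqnSn _)) pid_mx_1. Qed.

Let E_last (x : 'rV[C]_(m + n)) : (x *m E) 0 ord_max = 0.
Proof.
rewrite mxE big1// => i _; rewrite mxE /=.
by rewrite (ltn_eqF (ltn_ord i)) mulr0.
Qed.

Let E'E (y : 'rV[C]_N) : y 0 ord_max = 0 -> y *m E' *m E = y.
Proof.
move=> y0; rewrite -mulmxA mul_pid_mx !minnn; apply/rowP => k.
rewrite mxE (bigD1 k)//= big1 ?addr0 => [|j jk]; last first.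
  by rewrite mxE -val_eqE /= in jk *; rewrite (negbTE jk) mulr0.
rewrite mxE eqxx /=; have [_|kd] := ltnP k (m + n); first by rewrite mulr1.
suff -> : k = ord_max by rewrite y0 mul0r.
by apply/val_inj/eqP; rewrite eqn_leq kd -ltnS ltn_ord.
Qed.

Lemma cuspidal_form0_dual_defective :
  (1 <= m)%N -> cuspidal_form A B = 0 -> dual_defective A.
Proof.
move=> m1 P0 [S [_ [_ [p Sp] chart] SD]].
have mn0 : (0 < m + n)%N by rewrite addn_gt0 m1.
have det0 t : \det (hess A B t) = 0 by rewrite det_hess// P0 mpoly.meval0.
have sing x : exists2 v : 'rV[C]_(m + n), v != 0 & v *m horn_jac A B x = 0.
  by rewrite -(hsubmxK x); apply: horn_jac_singular.
have [U [V [phi [Up [oU oV phiU dphi [psi [psiK dpsi]]] SU]]]] := chart p Sp.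
have phiK y : V y -> phi (psi y) = y.
  by rewrite -phiU => -[u Uu <-]; rewrite psiK.
have : (phi @` (S `&` U)) (phi p) by exists p.
rewrite SU => -[Vp plast].
pose y0 := phi p *m E'.
have y0E : y0 *m E = phi p by apply: E'E; apply: plast => /=.
have [cE [cE0 hE]] := nrm_mulmx_ex E.
have [cE' [cE'0 hE']] := nrm_mulmx_ex E'.
(* Here y parametrizes a point of the hypersurface and x is one of its preimages under [horn]; the
   last clause is the Lipschitz bound for the chart at that point. *)
pose rel (k : nat) (y x : 'rV[C]_(m + n)) := [/\ nrm x <= k%:R, V (y *m E),
  horn A B x = psi (y *m E) &
  forall c, nrm (c - psi (y *m E)) <= k.+1%:R^-1 ->
    nrm (phi c - y *m E) <= k%:R * nrm (c - psi (y *m E))].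
have nd k (y1 : 'rV[C]_(m + n)) (rho : R) : 0 < rho -> exists y2 rho2,
    [/\ 0 < rho2, nrm (y2 - y1) + rho2 <= rho / 2 &
        forall y, (exists x, rel k y x) -> ~ nrm (y - y2) < rho2].
  move=> rho0.
  (* Taking k + 1 instead of k keeps the constant positive for k = 0. *)
  have c0 : 0 < cE' * k.+1%:R by rewrite mulr_gt0.
  have e0 : 0 < (k.+1%:R : R)^-1 by rewrite invr_gt0.
  have lip y x y' x' : rel k y x -> rel k y' x' ->
      nrm (horn A B x - horn A B x') <= k.+1%:R^-1 ->
      nrm (y - y') <= cE' * k.+1%:R * nrm (horn A B x - horn A B x').
    move=> [_ Vy hx _] [_ Vy' hx' hl] h.
    have := hl (horn A B x); rewrite -hx' => /(_ h).
    rewrite hx phiK// -mulmxBl => h1.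
    have -> : y - y' = (y - y') *m E *m E' by rewrite -mulmxA EE' mulmx1.
    rewrite (le_trans (hE' _ _))// -mulrA ler_pM2l// (le_trans h1)// ler_wpM2r ?nrm_ge0//.
    by rewrite ler_nat.
  have relk y x : rel k y x -> nrm x <= k%:R by case.
  have [y2 [rho2 [h1 h2 h3]]] := expmap_nowhere_dense mn0 sing c0 e0 relk lip y1 rho0.
  by exists y2, rho2; split=> // y [x]; exact: h3.
have [e [e0 he]] := iffLR (open_nrmP V) oV _ Vp.
have r0 : 0 < e / cE by rewrite divr_gt0.
have [l [ly0 hl]] := baire_nrm nd y0 r0.
have Vl : V (l *m E).
  apply: he; rewrite -y0E -mulmxBl (le_lt_trans (hE _ _))//.
  by rewrite mulrC -ltr_pdivlMr.
have : [set y | V y /\ forall i : 'I_N, (N.-1 <= i)%N -> y ord0 i = 0] (l *m E).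
  split=> // i hi; rewrite (_ : i = ord_max) ?E_last//.
  by apply/val_inj/eqP; rewrite eqn_leq hi -ltnS ltn_ord.
rewrite -SU => -[s [Ss Us] phis].
have ps : psi (l *m E) = s by rewrite -phis psiK.
have [_ [x sx]] := iffLR (dual_varietyP hA hB s) (SD s Ss).
have [k0 [d [k00 d0 hlip]]] := differentiable_locally_lip (dphi s Us).
(* An index above b dominates the norm of x and the Lipschitz constant at s, and its inverse lies
   below the radius d; so l belongs to one of the sets it was chosen to avoid. *)
pose b := nrm x + k0 + d^-1.
have d1 : 0 < d^-1 by rewrite invr_gt0.
have x0 := nrm_ge0 x.
pose k := Num.truncn b.
have kb : b < k.+1%:R by apply: truncnS_gt.
apply: (hl k.+1); exists x; split.
- by rewrite (le_trans _ (ltW kb))// /b -addrA lerDl addr_ge0// ltW.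
- by [].
- by rewrite ps.
move=> c; rewrite ps => hc; rewrite -phis.
have cd : nrm (c - s) < d.
  rewrite (le_lt_trans hc)// -[ltRHS]invrK ltf_pV2 ?posrE//.
  rewrite (@lt_trans _ _ k.+1%:R)// ?ltr_nat// (le_lt_trans _ kb)//.
  by rewrite /b lerDr addr_ge0// ltW.
rewrite (le_trans (hlip _ cd))// ler_wpM2r ?nrm_ge0//.
rewrite (le_trans _ (ltW kb))// /b; lra.
Qed.

Lemma torus_nbhs (c0 : 'rV[C]_N) : torus c0 ->
  exists e : R, 0 < e /\ forall c, nrm (c - c0) < e -> torus c.
Proof.
move=> T0; exists (\big[Num.min/1]_k nrm (c0 ord0 k)); split.
  apply: lt_bigmin => [|k _]; first exact: ltr01.
  by rewrite nrm_gt0; exact: T0.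
move=> c hc k; apply/eqP => ck.
have : nrm (c0 ord0 k) < nrm (c0 ord0 k).
  apply: (@le_lt_trans _ _ (nrm (c - c0))); last first.
    by apply: lt_le_trans hc _; exact: bigmin_le.
  by have := nrm_coord (c - c0) ord0 k; rewrite !mxE ck sub0r nrmN.
by rewrite ltxx.
Qed.

(** Evaluate where P_A times all the linear forms is nonzero. No form is zero: that would be a zero
    row of B, which makes the Hessian singular everywhere. *)
Lemma cuspidal_form_neq0_point : (0 < m + n)%N -> cuspidal_form A B != 0 ->
  exists t : 'rV[C]_m, \det (hess A B t) != 0 /\ forall k, (t *m B^T) 0 k != 0.
Proof.
move=> mn0 P0.
have ev (v : 'I_m -> C) p : mpoly.meval v p = mpoly.meval (fun i => (\row_i v i) 0 i) p.
  by apply: mpoly.meval_eq => i; rewrite mxE.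
have Bk0 k : linear_form B k != 0.
  have [v hv] := mpoly_nonvanishing P0; rewrite ev -det_hess// in hv.
  apply: contra hv => /eqP lk; apply/eqP/(hess_zero_row hA hB (k := k)) => //.
  apply/rowP => i; rewrite [LHS]mxE [RHS]mxE.
  have := linear_form_eval B (delta_mx 0 i) k; rewrite lk mpoly.meval0.
  by rewrite -rowE !mxE => <-.
have : cuspidal_form A B * \prod_k linear_form B k != 0.
  by rewrite mulf_neq0//; apply/prodf_neq0 => k _.
move=> /mpoly_nonvanishing[v]; rewrite ev mpoly.mevalM mulf_eq0 negb_or.
rewrite -det_hess// rmorph_prod => /andP[h1 /prodf_neq0 h2].
exists (\row_i v i); split=> // k; rewrite -linear_form_eval; exact: h2.
Qed.

Lemma dual_defective_cuspidal_form0 :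
  (1 <= m)%N -> dual_defective A -> cuspidal_form A B = 0.
Proof.
move=> m1 defect; apply/eqP/negPn/negP => P0; apply: defect.
have mn0 : (0 < m + n)%N by rewrite addn_gt0 m1.
have [t [dt lt]] := cuspidal_form_neq0_point mn0 P0.
pose x0 : 'rV[C]_(m + n) := row_mx t 0.
have x0T : torus (horn A B x0).
  by move=> k; rewrite hornE mulf_neq0 ?cexp_neq0.
have jf : row_free (horn_jac A B x0) by apply: horn_jac_free.
(* The Jacobian has only N - 1 rows, so some standard basis vector lies outside its row space. *)
have [e he] : exists e : 'rV[C]_N, ~~ (e <= horn_jac A B x0)%MS.
  have : ~~ ((1%:M : 'M[C]_N) <= horn_jac A B x0)%MS.
    by rewrite sub1mx /row_full; move/eqP: jf => ->; rewrite ltn_eqF.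
  by move=> /row_subPn[i hi]; exists (row i 1%:M).
pose L : 'M[C]_N := delta_mx ord_max (0 : 'I_1) *m e.
pose F := expmap (E' *m horn_P B) (E' *m horn_Q A) L.
have zL (z : 'rV[C]_N) : z *m L = z 0 ord_max *: e.
  rewrite /L mulmxA -colE [col _ _]mx11_scalar mul_scalar_mx.
  by rewrite mxE.
have FE (z : 'rV[C]_N) : F z = horn A B (z *m E') + z 0 ord_max *: e.
  apply/rowP => k; rewrite /F expmapE zL !mulmxA [RHS]mxE /horn expmapE.
  by rewrite mulmx0 [X in _ = _ + X + _]mxE addr0.
have JE (z v : 'rV[C]_N) : v *m expmap_jac (E' *m horn_P B) (E' *m horn_Q A) L z =
    v *m E' *m horn_jac A B (z *m E') + v 0 ord_max *: e.
  rewrite -zL -!mulmxA -mulmxDr; congr (_ *m _).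
  by rewrite /horn_jac /expmap_jac addr0 !mulmxA mulmxDr !mulmxA.
pose z0 := x0 *m E.
have z0E : z0 *m E' = x0 by rewrite /z0 -mulmxA EE' mulmx1.
have z0l : z0 0 ord_max = 0 by exact: E_last.
have uJ : expmap_jac (E' *m horn_P B) (E' *m horn_Q A) L z0 \in unitmx.
  rewrite -row_free_unit; apply: inj_row_free => v; rewrite JE z0E => h.
  have v0 : v 0 ord_max = 0.
    apply/eqP; apply: contraR he => vn.
    have -> : e = (- (v 0 ord_max)^-1 *: (v *m E')) *m horn_jac A B x0.
      move/eqP: h; rewrite addrC addr_eq0 => /eqP h.
      rewrite -scalemxAl scaleNr -scalerN -h scalerA mulVf// scale1r//.
    exact: submxMl.
  move: h; rewrite v0 scale0r addr0 => h.
  have vE : v *m E' = 0 by apply: (row_free_inj jf); rewrite h mul0mx.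
  by rewrite -(E'E v0) vE mul0mx.
have [eT [eT0 heT]] : exists e : R, 0 < e /\ forall z, nrm (z - z0) < e -> torus (F z).
  have Fz0 : F z0 = horn A B x0 by rewrite FE z0l scale0r addr0 z0E.
  have [e1 [e10 h1]] := torus_nbhs x0T.
  have [k [d [k0 d0 h2]]] := differentiable_locally_lip
    (expmap_diff (E' *m horn_P B) (E' *m horn_Q A) L z0).
  exists (Num.min d (e1 / k)); split; first by rewrite lt_min d0 divr_gt0.
  move=> z; rewrite lt_min => /andP[zd]; rewrite ltr_pdivlMr// => ze.
  apply: h1; rewrite -Fz0 (le_lt_trans (h2 _ zd))//.
  by rewrite mulrC.
have [U [V [phi [Vz0 bih UE phiF Ve]]]] := expmap_local_inverse eT0 uJ.
rewrite -/F in UE phiF.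
have [oU oV phiU dphi [psi [psiK dpsi]]] := bih.
pose S := F @` [set z | V z /\ z 0 ord_max = 0].
have SU : S `<=` U by rewrite UE => _ [z [Vz _] <-]; exists z.
exists S; split.
(* O is open by the local Lipschitz bound on [phi], and S is U minus O, hence locally closed. *)
- pose O := [set u | U u /\ phi u 0 ord_max != 0].
  exists U, (~` O); split => //.
    apply: open_closedC; apply/open_nrmP => u [Uu hu].
    have [e1 [e10 h1]] := iffLR (open_nrmP U) oU _ Uu.
    have [k [d [k0 d0 h2]]] := differentiable_locally_lip (dphi u Uu).
    have hu0 : 0 < nrm (phi u 0 ord_max) by rewrite nrm_gt0.
    exists (Num.min (Num.min d e1) (nrm (phi u 0 ord_max) / k)); split.
      by rewrite !lt_min d0 e10 divr_gt0.
    move=> y; rewrite !lt_min => /andP[/andP[yd ye]]; rewrite ltr_pdivlMr// => yk.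
    split; first exact: h1.
    apply/eqP => y0; have := nrm_coord (phi y - phi u) 0 ord_max.
    rewrite !mxE y0 sub0r nrmN => h3; have := h2 _ yd.
    by rewrite leNgt => /negP; apply; rewrite mulrC (lt_le_trans yk).
  apply/seteqP; split=> [_ [z [Vz zl] <-]|u [Uu /= hu]].
    split; first by rewrite UE; exists z.
    by move=> [_]; rewrite phiF// zl eqxx.
  have Uu' := Uu; rewrite UE in Uu'; have [z Vz zu] := Uu'.
  exists z => //; split=> //; apply/eqP/negPn/negP => zl; apply: hu; split=> //.
  by rewrite -zu phiF.
- split; first exact: leqnSn.
    by exists (F z0); exists z0.
  move=> p Sp; exists U, V, phi; split=> //; first exact: SU.
  apply/seteqP; split=> [_ [_ [[z [Vz zl] <-] _] <-]|y [Vy hy]].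
    rewrite phiF//; split=> // i hi; rewrite (_ : i = ord_max)//.
    by apply/val_inj/eqP; rewrite eqn_leq hi -ltnS ltn_ord.
  exists (F y); last by rewrite phiF.
  by split; [exists y => //; split=> //; exact: hy|rewrite UE; exists y].
- move=> _ [z [Vz zl] <-]; apply/(dual_varietyP hA hB); split.
    by apply: heT; exact: Ve.
  by exists (z *m E'); rewrite FE zl scale0r addr0.
Qed.

End Main.

Theorem theorem6p1 (R : realType) (n N m : nat) (A : 'M[R]_(n.+1, N))
    (B : 'M[Cplx R]_(N, m))
    (n_ge1 : (1 <= n)%N) (mE : m = (N - n - 1)%N) (m_ge1 : (1 <= m)%N)
    (hA : point_configuration A) (hB : gale_dual A B) :
  dual_defective A <-> cuspidal_form A B = 0%R.
Proof.
(* As m >= 1, the natural subtraction in [mE] is not truncated. *)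
have NE : N = (m + n).+1 by lia.
move: A B hA hB; rewrite NE => {mE NE} A B hA hB.
by split; [exact: dual_defective_cuspidal_form0|exact: cuspidal_form0_dual_defective].
Qed.
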